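(* Let $\mathbf{A}$ be an $n\times n\times n$ tensor with independent $\mathcal{N}(0,1)$ entries and let $\mathbf{A}(x)=\sum_{i,j,k}\mathbf{A}_{ijk}x_ix_jx_k$. There is an absolute constant $C$ such that with probability $1-O(n^{-10})$ the polynomial $\mathbf{A}(x)$ is $\lambda$-bounded with $\lambda= C\, n^{3/4}(\log n)^{1/4}$. Consequently, with the same probability, every degree-$4$ pseudo-expectation $\tilde{\mathbb{E}}$ satisfies $\tilde{\mathbb{E}}\,\mathbf{A}(x)\le C n^{3/4}(\log n)^{1/4}(\tilde{\mathbb{E}}\|x\|^4)^{3/4}$.
   Context: A degree-$d$ pseudo-expectation ($d$ even) is a linear functional $\tilde{\mathbb{E}}:\mathbb{R}[x]_{\le d}\to\mathbb{R}$ with $\tilde{\mathbb{E}}\,1=1$ and $\tilde{\mathbb{E}}\,p(x)^2\ge 0$ for every polynomial $p$ of degree at most $d/2$. A matrix $M\in\mathbb{R}^{n^2\times n^2}$ is a matrix representation of $\|x\|^4$ if $\langle x^{\otimes 2}, M x^{\otimes 2}\rangle=\|x\|^4$. A homogeneous cubic $f$ is $\lambda$-bounded if there exist $A_1,\dots,A_n\in\mathbb{R}^{n\times n}$ with $f(x)=\sum_i x_i\langle x,A_ix\rangle$ and a matrix representation $M$ of $\|x\|^4$ with $\langle u,(\lambda^2M-\sum_iA_i\otimes A_i)u\rangle\ge 0$ for all $u\in\mathbb{R}^{n^2}$. *)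

(* Defs.v *)
From HB Require Import structures.
From mathcomp Require Import all_boot all_order all_algebra.
(* mpoly must be imported BEFORE mathcomp-analysis (otherwise notation clash) *)
From mathcomp Require Import mpoly.
From mathcomp Require Import all_classical all_reals all_analysis.
From mathcomp Require Import mxtens.

Set Implicit Arguments.
Unset Strict Implicit.
Unset Printing Implicit Defensive.

Import Order.TTheory GRing.Theory Num.Theory.
Local Open Scope classical_set_scope.
Local Open Scope ring_scope.

Section Defs.
Context {R : realType}.

Definition Xv (n : nat) (i : 'I_n) : {mpoly R[n]} :=
  'X_i.

(* total degree at most d; msize p = 1 + total degree (0 for p = 0) *)
Definition deg_le (n : nat) (d : nat) (p : {mpoly R[n]}) : bool :=
  (msize p <= d.+1)%N.

Definition tensor_poly (n : nat) (a : 'I_n -> 'I_n -> 'I_n -> R)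
  : {mpoly R[n]} :=
  \sum_(i < n) \sum_(j < n) \sum_(k < n) a i j k *: (Xv i * Xv j * Xv k).

Definition norm4_poly (n : nat) : {mpoly R[n]} :=
  (\sum_(i < n) Xv i ^+ 2) ^+ 2.

Definition dotv (m : nat) (u v : 'cV[R]_m) : R := (u^T *m v) 0 0.

(* degree-d pseudo-expectation: a linear functional on R[x]_{<= d}
   (its values outside R[x]_{<= d} are irrelevant) *)
Definition pseudo_expectation (n d : nat) (E : {mpoly R[n]} -> R) : Prop :=
  [/\ (forall (c : R) (p q : {mpoly R[n]}), deg_le d p -> deg_le d q ->
          E (c *: p + q) = c * E p + E q),
      E 1 = 1
    & forall p : {mpoly R[n]}, deg_le (d./2) p -> 0 <= E (p * p)].

Definition lambda_bounded (n : nat) (f : {mpoly R[n]}) (lam : R) : Prop :=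
  exists (A : 'I_n -> 'M[R]_n) (M : 'M[R]_(n * n)),
    [/\ (forall x : 'cV[R]_n,
            f.@[fun i => x i 0] = \sum_(i < n) x i 0 * dotv x (A i *m x)),
        (forall x : 'cV[R]_n,
            dotv (x *t x) (M *m (x *t x)) = (\sum_(i < n) x i 0 ^+ 2) ^+ 2)
      & (forall u : 'cV[R]_(n * n),
            0 <= dotv u ((lam ^+ 2 *: M - \sum_(i < n) (A i *t A i)) *m u))].

Definition mutually_independent (d : measure_display) (T : measurableType d)
  (P : probability T R) (I : finType) (X : I -> {RV P >-> R}) : Prop :=
  forall B : I -> set R, (forall i, measurable (B i)) ->
    P (\bigcap_(i in [set: I]) (X i @^-1` B i)) = (\prod_(i : I) P (X i @^-1` B i))%E.

Definition std_normal (d : measure_display) (T : measurableType d)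
  (P : probability T R) (X : {RV P >-> R}) : Prop :=
  forall B : set R, measurable B -> P (X @^-1` B) = normal_prob 0 1 B.

End Defs.

(* Main.v *)
Require Import Defs.
From HB Require Import structures.
From mathcomp Require Import all_boot all_order all_algebra.
From mathcomp Require Import mpoly.
From mathcomp Require Import all_classical all_reals all_analysis.
From mathcomp Require Import mxtens.
From mathcomp Require Import measurable_realfun.
From mathcomp Require Import ring lra.
Import Order.TTheory GRing.Theory Num.Theory.
Local Open Scope classical_set_scope.
Local Open Scope ring_scope.

Set Implicit Arguments.
Unset Strict Implicit.
Unset Printing Implicit Defensive.

(* Since only quadratic forms matter, the matrix [M] may be chosen so that the
   diagonal blocks [U_aa U_cd] of [sum_i A_i (x) A_i] are moved to the positions
   [U_ac U_ad], which represent the same quartic; there they are bounded by the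
   squared injective norm of the tensor, which is O(n). What remains is the
   chaos [sum_i sum_(a != b) U_ab A_iac A_ibd U_cd], i.e. two copies (for [U] and
   its transpose) of the part [a < b]. Read in the order of the index [b], this
   part is a Gaussian martingale whose quadratic variation is at most the squared
   injective norm times [|U|^2 |V|^2], hence O(n). The exponential martingale
   [exp (sum_t (c_t X_t - c_t^2 / 2))] has mean 1, and its Chernoff bound
   exp(- c n^2) beats a net of exp(O(n^2)) pairs [(U, V)] at the level n^(3/2);
   so [lam^2] of order n^(3/2) suffices. The bound on pseudo-expectations follows
   by applying the certificate to the moment matrix and Cauchy-Schwarz twice. *)

(** * Gaussian integrals and independence *)

(** Change of variables by the Radon-Nikodym derivative, which agrees almost everywhere with
    [normal_pdf] because both have the same integral over every measurable set. *)
Lemma ge0_integral_normal_prob (R : realType) (m s : R) (f : R -> \bar R) :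
  measurable_fun setT f -> (forall x, 0 <= f x)%E ->
  (\int[normal_prob m s]_x f x =
   \int[lebesgue_measure]_x (f x * (normal_pdf m s x)%:E))%E.
Proof.
move=> mf f0; set mu := lebesgue_measure.
have dom := normal_prob_dominates m s.
rewrite -(Radon_Nikodym_SigmaFinite.change_of_variables
  (nu := normal_prob m s) (mu := mu) dom)//.
have mpdf : measurable_fun setT (fun x : R => (normal_pdf m s x)%:E).
  by apply/measurable_EFinP; exact: measurable_normal_pdf.
apply: ae_eq_integral => //.
- apply: emeasurable_funM => //.
  exact: measurable_int (Radon_Nikodym_SigmaFinite.f_integrable dom).
- exact: emeasurable_funM.
- apply: ae_eqe_mul2l.
  apply: integral_ae_eq => //.
    exact: Radon_Nikodym_SigmaFinite.f_integrable.
  by move=> E _ mE; rewrite -Radon_Nikodym_SigmaFinite.f_integral.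
Qed.

(** Completing the square: the factor turns the standard density into the normal density of mean
    [c]. *)
Lemma integral_std_normal_expR (R : realType) (c : R) :
  (\int[normal_prob (0 : R) 1]_x (expR (c * x - c ^+ 2 / 2))%:E = 1)%E.
Proof.
rewrite ge0_integral_normal_prob; first last.
- by move=> x; rewrite lee_fin expR_ge0.
- apply/measurable_EFinP; apply: measurableT_comp => //.
  by apply: measurable_funB => //; exact: measurable_funM.
rewrite -[RHS](integral_normal_pdf c 1); apply: eq_integral => x _.
rewrite -EFinM; congr (_%:E).
rewrite !normal_pdfE ?oner_eq0// mulrCA; congr (_ * _).
by rewrite /normal_fun -expRD; congr expR; field.
Qed.

Section independent_pair.
Context (R : realType) (d : measure_display) (T : measurableType d).
Variables (P : probability T R) (G : set (set T)) (X : {RV P >-> R}).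
Hypotheses (Gm : G `<=` measurable) (GT : G setT) (GI : setI_closed G).
Hypothesis GX : forall C B, G C -> measurable B ->
  (P (C `&` X @^-1` B) = P C * P (X @^-1` B))%E.

(** For fixed [B] both sides are finite measures in [C] that agree on the pi-system [G], hence on
    the sigma-algebra it generates. *)
Lemma independent_g_sigma (C : set T) (B : set R) :
  <<s G >> C -> measurable B -> (P (C `&` X @^-1` B) = P C * P (X @^-1` B))%E.
Proof.
move=> GC mB.
have mXB : measurable (X @^-1` B) by rewrite -[_ @^-1` _]setTI; exact: measurable_funPT.
have Pfin : P (X @^-1` B) \is a fin_num by rewrite fin_num_measure.
have P0 : 0 <= fine (P (X @^-1` B)) by rewrite fine_ge0.
have := @g_sigma_algebra_measure_unique _ R T G Gm (fun=> setT) (fun=> GT) _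
  (mrestr P mXB) (mscale (NngNum P0) P) GI _ _ C GC.
rewrite /= /mrestr /mscale /= => ->.
- by rewrite fineK// muleC.
- by apply/seteqP; split=> // x _; exists 0%N.
- by move=> A GA; rewrite GX// fineK// muleC.
- by move=> _; rewrite setTI -ge0_fin_numE.
Qed.

(** The same points with the smaller sigma-algebra; a function measurable on [T'] depends only on
    the information in [G]. *)
Let T' : measurableType _ := g_sigma_algebraType G.

Lemma measurable_id_g_sigma : measurable_fun setT (id : T -> T').
Proof.
move=> _ A mA; rewrite setTI.
by apply: (smallest_sub (@sigma_algebra_measurable _ T) Gm).
Qed.

Let ident : {mfun T >-> T'} := HB.pack (id : T -> T')
  (isMeasurableFun.Build _ _ _ _ _ measurable_id_g_sigma).

(** Freezing: by [independent_g_sigma] the joint law of the identity into [T'] and of [X] agrees on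
    rectangles with the product law, so Tonelli applies. *)
Lemma ge0_integral_independent (f : T' * R -> \bar R) :
  measurable_fun setT f -> (forall x, 0 <= f x)%E ->
  (\int[P]_w f (w, X w) =
   \int[P]_w \int[distribution P X]_x f (w, x))%E.
Proof.
move=> mf f0.
pose phi (w : T) : T' * R := (w, X w).
have mphi : measurable_fun setT phi.
  apply/measurable_fun_pairP; split => /=.
    exact: measurable_id_g_sigma.
  exact: measurable_funPT.
pose P' := distribution P (ident : {RV P >-> T'}).
have -> : (\int[P]_w f (w, X w) = \int[pushforward P phi]_z f z)%E.
  by rewrite ge0_integral_pushforward.
transitivity (\int[(P' \x distribution P X)%E]_z f z)%E.
  apply: eq_measure_integral => A mA _; apply/esym.
  pose phi' : {mfun T >-> (T' * R)%type} :=
    HB.pack phi (isMeasurableFun.Build _ _ _ _ _ mphi).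
  have := @product_measure_unique _ _ _ _ _ P' (distribution P X)
    (distribution P (phi' : {RV P >-> (T' * R)%type})) _ A mA.
  apply=> C B mC mB.
  exact: independent_g_sigma.
rewrite fubini_tonelli1// /fubini_F.
rewrite (@ge0_integral_distribution _ _ _ _ _ _ ident)//.
- exact: measurable_fun_fubini_tonelli_F.
- by move=> w; apply: integral_ge0 => x _.
Qed.

End independent_pair.

Lemma ge0_integral_std_normal (R : realType) (d : measure_display)
    (T : measurableType d) (P : probability T R) (X : {RV P >-> R})
    (f : R -> \bar R) : std_normal X ->
  measurable_fun setT f -> (forall x, 0 <= f x)%E ->
  (\int[distribution P X]_x f x = \int[normal_prob (0 : R) 1]_x f x)%E.
Proof.
move=> nX mf f0.
(* [R] carries two displays: the default one, used by [{RV P >-> R}], and that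
   of [measurableTypeR R], used by [normal_prob]. *)
pose idR (x : measurableTypeR R) : R := x.
have midR : measurable_fun setT idR by move=> _ B mB; rewrite setTI.
transitivity (\int[pushforward (normal_prob (0 : R) 1) idR]_x f x)%E.
  by apply: eq_measure_integral => A mA _; exact: nX.
by rewrite ge0_integral_pushforward.
Qed.

(** * The exponential martingale of a Gaussian family *)

Section exponential_martingale.
Context (R : realType) (d : measure_display) (T : measurableType d).
Variables (P : probability T R) (I : finType) (X : I -> {RV P >-> R}).
Hypotheses (indepX : mutually_independent X) (normX : forall i, std_normal (X i)).
Variables (rank : I -> nat) (a : I -> R) (k : I -> I -> R).
Hypothesis rank_inj : injective rank.

(** Predictable coefficient: it is already determined when [X t] is integrated out. *)
Let c t w := a t + \sum_(s | (rank s < rank t)%N) k t s * X s w.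

(** Cylinders constraining only the variables of rank below [m]. Taking cylinders instead of the
    generated sigma-algebra gives a pi-system on which independence is the product formula. *)
Let past (m : nat) : set (set T) :=
  [set C | exists B : I -> set R, [/\ forall i, measurable (B i),
    forall i, (m <= rank i)%N -> B i = setT &
    C = \bigcap_(i in [set: I]) (X i @^-1` B i)]].

Let past_measurable m : past m `<=` measurable.
Proof.
move=> _ [B [mB _ ->]].
apply: fin_bigcap_measurable => // i _.
by rewrite -[_ @^-1` _]setTI; exact: measurable_funPT.
Qed.

Let past_setT m : past m setT.
Proof.
exists (fun=> setT); split=> //.
by apply/seteqP; split=> // w _ i _.
Qed.

Let past_setI m : setI_closed (past m).
Proof.
move=> _ _ [B [mB BT ->]] [B' [mB' BT' ->]].
exists (fun i => B i `&` B' i); split.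
- by move=> i; exact: measurableI.
- by move=> i mi; rewrite BT// BT'// setTI.
- apply/seteqP; split=> w.
    by move=> [h h'] i _; split; [exact: h|exact: h'].
  by move=> h; split=> i _; have [] := h i Logic.I.
Qed.

(** A past cylinder leaves coordinate [t] free, so intersecting with the event on [X t] is again a
    cylinder, and the two product formulas differ in one factor. *)
Let past_indep m t C B : (m <= rank t)%N -> past m C -> measurable B ->
  (P (C `&` X t @^-1` B) = P C * P (X t @^-1` B))%E.
Proof.
move=> mt [B' [mB' BT' ->]] mB.
pose B2 i := if i == t then B else B' i.
have -> : \bigcap_(i in [set: I]) (X i @^-1` B' i) `&` X t @^-1` B =
          \bigcap_(i in [set: I]) (X i @^-1` B2 i).
  apply/seteqP; split=> w.
    by move=> [h hB] i _; rewrite /B2; case: eqP => [->//|_]; exact: h.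
  move=> h; split; last by have := h t Logic.I; rewrite /B2 eqxx.
  move=> i _; have := h i Logic.I; rewrite /B2; case: eqP => [->|//] _.
  by rewrite BT'.
rewrite indepX; last by move=> i; rewrite /B2; case: eqP.
rewrite indepX// (bigD1 t)//= [in RHS](bigD1 t)//= /B2 eqxx BT'//.
rewrite preimage_setT probability_setT mul1e muleC; congr (_ * _)%E.
by apply: eq_bigr => i /negbTE ->.
Qed.

Let past_X m s : (rank s < m)%N ->
  measurable_fun [set: g_sigma_algebraType (past m)]
    (X s : g_sigma_algebraType (past m) -> R).
Proof.
move=> sm _ B mB; rewrite setTI; apply: sub_sigma_algebra.
exists (fun i => if i == s then B else setT); split.
- by move=> i; case: eqP.
- by move=> i; case: eqP => // ->; rewrite leqNgt sm.
- apply/seteqP; split=> w /=.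
    by move=> h i _ /=; case: eqP => // ->.
  by move=> /(_ s Logic.I) /=; rewrite eqxx.
Qed.

Let past_c m t : (rank t <= m)%N ->
  measurable_fun [set: g_sigma_algebraType (past m)]
    (c t : g_sigma_algebraType (past m) -> R).
Proof.
move=> tm; apply: measurable_funD; first exact: measurable_cst.
rewrite [X in measurable_fun _ X](_ : _ = fun w =>
  \sum_(s <- enum I) (if (rank s < rank t)%N then k t s * X s w else 0)).
  apply: measurable_sum => s /=.
  case: (boolP (rank s < rank t)%N) => [st|_]; last exact: measurable_cst.
  apply: measurable_funM; first exact: measurable_cst.
  by apply: past_X; exact: leq_trans tm.
by apply/funext => w; rewrite big_enum/= big_mkcond.
Qed.

Let term t w := c t w * X t w - c t w ^+ 2 / 2.

Let past_S m : measurable_fun [set: g_sigma_algebraType (past m)]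
    ((fun w => \sum_(t | (rank t < m)%N) term t w) : g_sigma_algebraType (past m) -> R).
Proof.
rewrite [X in measurable_fun _ X](_ : _ = fun w =>
  \sum_(t <- enum I) (if (rank t < m)%N then term t w else 0)); last first.
  by apply/funext => w; rewrite big_enum/= big_mkcond.
apply: measurable_sum => t /=.
case: (boolP (rank t < m)%N) => [tm|_]; last exact: measurable_cst.
have mc := past_c (ltnW tm).
apply: measurable_funB.
  by apply: measurable_funM => //; exact: past_X.
by apply: measurable_funM => //; exact: measurable_funX.
Qed.

(** Induction on the rank: conditionally on the past, the factor of the variable of highest rank is
    a Gaussian tilt with frozen coefficient, of mean 1. *)
Lemma integral_expR_martingale :
  (\int[P]_w (expR (\sum_t (c t w * X t w - c t w ^+ 2 / 2)))%:E = 1)%E.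
Proof.
have E m : (\int[P]_w (expR (\sum_(t | (rank t < m)%N) term t w))%:E = 1)%E.
  elim: m => [|m IH].
    under eq_integral do rewrite big_pred0// expR0.
    by rewrite integral_cst// mul1e; exact: probability_setT.
  (* Ranks may have gaps; a rank that is not attained adds no term. An attained one belongs to a
     single index, by [rank_inj]. *)
  have [[t0 t0m]|nt] := pselect (exists t, rank t = m); last first.
    rewrite -[RHS]IH; apply: eq_integral => w _; congr (expR _)%:E.
    apply: eq_bigl => t; rewrite ltnS leq_eqVlt; case: eqP => // tm.
    by case: nt; exists t.
  pose f (z : g_sigma_algebraType (past m) * R) : \bar R :=
    (expR (\sum_(t | (rank t < m)%N) term t z.1
           + (c t0 z.1 * z.2 - c t0 z.1 ^+ 2 / 2)))%:E.
  have mf : measurable_fun [set: _] f.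
    apply/measurable_EFinP; apply: measurableT_comp => //=.
    have mc : measurable_fun [set: _]
        (fun z : g_sigma_algebraType (past m) * R => c t0 z.1).
      by apply: (measurableT_comp (past_c _)) => //; rewrite t0m.
    have mS : measurable_fun [set: _] (fun z : g_sigma_algebraType (past m) * R =>
        \sum_(t | (rank t < m)%N) term t z.1).
      by apply: (measurableT_comp (@past_S m)).
    apply: measurable_funD; first exact: mS.
    apply: measurable_funB; first exact: measurable_funM.
    by apply: measurable_funM => //; exact: measurable_funX.
  transitivity (\int[P]_w f (w, X t0 w))%E.
    apply: eq_integral => w _; congr (expR _)%:E.
    rewrite (bigD1 t0) ?t0m//= addrC; congr (_ + _).
    apply: eq_bigl => t; rewrite ltnS leq_eqVlt -t0m (inj_eq rank_inj).
    by case: eqP => [->|_]; rewrite ?ltnn ?andbT.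
  rewrite (@ge0_integral_independent _ _ _ P (past m) (X t0))//; first last.
  - by move=> z; rewrite lee_fin expR_ge0.
  - by move=> C B; apply: past_indep; rewrite t0m.
  rewrite -[RHS]IH; apply: eq_integral => w _ /=.
  have -> : (\int[distribution P (X t0)]_x f (w, x) =
             \int[normal_prob 0 1]_x f (w, x))%E.
    apply: ge0_integral_std_normal => // [|x]; last by rewrite lee_fin expR_ge0.
    apply/measurable_EFinP; apply: measurableT_comp => //=.
    apply: measurable_funD => //=; apply: measurable_funB => //; exact: measurable_funM.
  rewrite /f /=; under eq_integral do rewrite expRD EFinM.
  rewrite ge0_integralZl//.
  - by rewrite integral_std_normal_expR mule1.
  - apply/measurable_EFinP; apply: measurableT_comp => //.
    by apply: measurable_funB => //; exact: measurable_funM.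
rewrite -[RHS](E (\max_t rank t).+1); apply: eq_integral => w _.
congr (expR _)%:E; apply: eq_bigl => t.
by rewrite ltnS leq_bigmax.
Qed.

End exponential_martingale.

Lemma measurable_martingale_exponent (R : realType) (d : measure_display)
    (T : measurableType d) (I : finType) (X : I -> T -> R)
    (rank : I -> nat) (a : I -> R) (k : I -> I -> R) :
  (forall i, measurable_fun setT (X i)) ->
  let c t w := a t + \sum_(s | (rank s < rank t)%N) k t s * X s w in
  measurable_fun setT (fun w => \sum_t (c t w * X t w - c t w ^+ 2 / 2)).
Proof.
move=> mX c.
have mc t : measurable_fun setT (c t).
  apply: measurable_funD => //.
  rewrite [X in measurable_fun _ X](_ : _ = fun w =>
    \sum_(s <- enum I) (if (rank s < rank t)%N then k t s * X s w else 0)).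
    apply: measurable_sum => s /=.
    by case: (boolP (rank s < rank t)%N) => // _; exact: measurable_funM.
  by apply/funext => w; rewrite big_enum/= big_mkcond.
rewrite [X in measurable_fun _ X](_ : _ = fun w =>
  \sum_(t <- enum I) (c t w * X t w - c t w ^+ 2 / 2)); last first.
  by apply/funext => w; rewrite big_enum.
apply: measurable_sum => t /=; apply: measurable_funB; first exact: measurable_funM.
by apply: measurable_funM => //; exact: measurable_funX.
Qed.

(** Markov's inequality for the sum [S] of all [expR (Y q)], whose mean is the size of [N]; where
    [S < expR L], each summand is below [expR L] too. *)
Lemma exponential_union_bound (R : realType) (d : measure_display)
    (T : measurableType d) (P : probability T R) (Q : eqType) (N : seq Q)
    (Y : Q -> T -> R) (L : R) :
  (forall q, measurable_fun setT (Y q)) ->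
  (forall q, (\int[P]_w (expR (Y q w))%:E = 1)%E) ->
  exists E : set T, [/\ measurable E,
    (P (~` E) <= ((size N)%:R * expR (- L))%:E)%E
    & forall w, E w -> forall q, q \in N -> Y q w <= L].
Proof.
move=> mY intY.
pose S w := \sum_(q <- N) expR (Y q w).
have mS : measurable_fun setT S.
  by apply: measurable_sum => q; exact: measurableT_comp.
have S0 w : 0 <= S w by apply: sumr_ge0 => q _; rewrite expR_ge0.
have mE : measurable [set w | S w < expR L].
  rewrite -[X in measurable X]setTI.
  apply: (measurable_fun_ltr mS (measurable_cst _)) => //.
exists [set w | S w < expR L]; split=> //; last first.
  move=> w /= SL q qN; rewrite -ler_expR; apply: le_trans (ltW SL).
  rewrite /S (perm_big _ (perm_to_rem qN))/= big_cons lerDl.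
  by apply: sumr_ge0 => r _; rewrite expR_ge0.
have intS : (\int[P]_w (S w)%:E = (size N)%:R%:E)%E.
  under eq_integral do rewrite -sumEFin.
  rewrite ge0_integral_sum//.
  - under eq_bigr do rewrite intY.
    rewrite sumEFin; congr _%:E.
    by elim: (N) => [|q s IH]; rewrite ?big_nil// big_cons IH -natr1 addrC.
  by move=> q; apply/measurable_EFinP; exact: measurableT_comp.
rewrite expRN EFinM -intS lee_pdivlMr ?expR_gt0//.
have mEC := measurableC mE.
set F := ~` _ in mEC *.
have -> : (P F * (expR L)%:E = \int[P]_(w in F) (expR L)%:E)%E.
  by rewrite integral_cst// muleC.
apply: (@le_trans _ _ (\int[P]_(w in F) (S w)%:E)%E).
  apply: ge0_le_integral => //=.
  - by apply/measurable_EFinP; exact: measurable_funTS.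
  - by move=> w /negP; rewrite -leNgt lee_fin.
apply: ge0_subset_integral => //.
- exact/measurable_EFinP.
- by move=> w _; rewrite lee_fin.
Qed.

(** * Nets of Euclidean balls *)

Section euclidean.
Context (R : realType).

Definition sqnorm (I : finType) (x : I -> R) : R := \sum_i x i ^+ 2.

Definition trilin (I J K : finType) (F : I -> J -> K -> R)
    (w : I -> R) (x : J -> R) (y : K -> R) : R :=
  \sum_i \sum_j \sum_k w i * x j * y k * F i j k.

Lemma sqnorm_ge0 (I : finType) (x : I -> R) : 0 <= sqnorm x.
Proof. by apply: sumr_ge0 => i _; rewrite sqr_ge0. Qed.

Lemma sqnormZ (I : finType) (c : R) (x : I -> R) :
  sqnorm (fun i => c * x i) = c ^+ 2 * sqnorm x.
Proof. by rewrite /sqnorm mulr_sumr; apply: eq_bigr => i _; rewrite exprMn. Qed.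

Lemma coord_sqr_le_sqnorm (I : finType) (x : I -> R) i : x i ^+ 2 <= sqnorm x.
Proof.
by rewrite /sqnorm (bigD1 i)//= lerDl; apply: sumr_ge0 => j _; rewrite sqr_ge0.
Qed.

Lemma coord_norm_le1 (I : finType) (x : I -> R) i : sqnorm x <= 1 -> `|x i| <= 1.
Proof.
move=> x1; rewrite -(@ler_pXn2r _ 2)// ?nnegrE// expr1n real_normK ?num_real//.
exact: le_trans (coord_sqr_le_sqnorm x i) x1.
Qed.

Lemma sum_geometric_half (L : nat) : \sum_(k < L) (2^-1 : R) ^+ k <= 2.
Proof.
suff -> : \sum_(k < L) (2^-1 : R) ^+ k = 2 - 2 * 2^-1 ^+ L.
  by rewrite gerBl mulr_ge0// exprn_ge0// invr_ge0.
elim: L => [|L IH]; first by rewrite big_ord0 expr0 mulr1 subrr.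
by rewrite big_ord_recr/= IH exprS; field.
Qed.

Lemma two_le_expR1 : 2 <= expR 1 :> R.
Proof. by have := expR_ge1Dx (1 : R). Qed.

(* The lattice points [z / s] with [s = 8 sqrt m], in sign-magnitude form; those
   in the unit ball satisfy [sum |z_i| <= 8 m], so that weighting [z] by
   [2 ^ (8 m - sum |z_i|) >= 1] bounds their number by [2 ^ (10 m)]. *)
Lemma ball_net (I : finType) : exists N : seq {ffun I -> R},
  [/\ (size N)%:R <= expR (10 * #|I|%:R) :> R,
      forall y, y \in N -> sqnorm y <= 1
    & forall x : I -> R, sqnorm x <= 1 ->
        exists2 y, y \in N & sqnorm (fun i => x i - y i) <= 8^-1 ^+ 2].
Proof.
set m := #|I|.
pose L := (8 * m).+1.
pose s : R := 8 * Num.sqrt m%:R.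
have s2 : s ^+ 2 = 64 * m%:R by rewrite exprMn sqr_sqrtr// -natrX.
have s0 : 0 <= s by rewrite mulr_ge0// sqrtr_ge0.
have sgt0 : (0 < m)%N -> 0 < s by move=> m0; rewrite mulr_gt0// sqrtr_gt0 ltr0n.
(* Ensures that the magnitudes [|x i| * s] of points of the unit ball, rounded down, fit into
   ['I_L]. *)
have sle : s <= (8 * m)%:R.
  rewrite natrM ler_wpM2l// -[leRHS]ger0_norm// -sqrtr_sqr ler_wsqrtr//.
  by rewrite -natrX ler_nat -mulnn; case: (m) => // m'; rewrite leq_pmull.
clearbody s.
pose pt (z : {ffun I -> bool * 'I_L}) : {ffun I -> R} :=
  [ffun i => (-1) ^+ (z i).1 * ((z i).2%:R / s)].
pose good (z : {ffun I -> bool * 'I_L}) := sqnorm (pt z) <= 1.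
exists [seq pt z | z <- enum {ffun I -> bool * 'I_L} & good z]; split.
- rewrite size_map size_filter -sum1_count big_enum_cond/= natr_sum.
  have weight (z : {ffun I -> bool * 'I_L}) : good z ->
      1 <= 2 ^+ (8 * m) * \prod_i (2^-1 : R) ^+ (z i).2.
    move=> gz; rewrite prodrXr exprVn ler_pdivlMr ?exprn_gt0//.
    rewrite mul1r ler_eXn2l ?ltr1n//.
    have [m0|m0] := posnP m.
      rewrite big1// => i _; have := max_card (pred1 i).
      by rewrite card1 -/m m0.
    move/sgt0: m0 => {}sgt0.
    suff : \sum_i ((z i).2 : nat)%:R <= 8 * m%:R :> R.
      by rewrite -natr_sum -(natrM _ 8) ler_nat.
    have h1 : \sum_i ((z i).2%:R : R) ^+ 2 <= 64 * m%:R.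
      have -> : \sum_i ((z i).2%:R : R) ^+ 2 = s ^+ 2 * sqnorm (pt z).
        rewrite /sqnorm mulr_sumr; apply: eq_bigr => i _; rewrite ffunE.
        by rewrite exprMn sqrr_sign mul1r exprMn exprVn mulrC divfK// gt_eqF// exprn_gt0.
      by rewrite -s2 ler_piMr// sqr_ge0.
    (* From [(t - 8)^2 >= 0]; with [h1] the two summands contribute [4 m] each. *)
    have h2 : \sum_i ((z i).2%:R : R) <= \sum_i (((z i).2%:R : R) ^+ 2 / 16 + 4).
      by apply: ler_sum => i _; have := sqr_ge0 ((z i).2%:R - 8 : R); nra.
    apply: (le_trans h2); rewrite big_split/= -mulr_suml sumr_const -/m -mulr_natr.
    by lra.
  apply: (@le_trans _ _ (\sum_(z : {ffun I -> bool * 'I_L})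
      2 ^+ (8 * m) * \prod_i (2^-1 : R) ^+ (z i).2)).
    rewrite big_mkcond/=; apply: ler_sum => z _; case: ifP => [/weight //|_].
    by rewrite mulr_ge0 ?exprn_ge0// prodr_ge0// => i _; rewrite exprn_ge0 ?invr_ge0.
  (* The weights factor over coordinates. Two signs times a geometric series give at most 4 per
     coordinate, so the total is at most [(2^8 * 4)^m = 2^(10 m)]. *)
  rewrite -mulr_sumr -(bigA_distr_bigA (fun (_ : I) (p : bool * 'I_L) => (2^-1 : R) ^+ p.2)).
  have -> : 10 * m%:R = m%:R * 10 :> R by rewrite mulrC.
  rewrite expRM_natl.
  have h : \sum_(p : bool * 'I_L) (2^-1 : R) ^+ p.2 <= 4.
    rewrite -(pair_bigA _ (fun (b : bool) (k : 'I_L) => (2^-1 : R) ^+ k))/=.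
    rewrite sumr_const card_bool; have := sum_geometric_half L; rewrite mulr2n; lra.
  rewrite prodr_const -/m exprM -exprMn.
  apply: lerXn2r; rewrite ?nnegrE ?expR_ge0//.
    by rewrite mulr_ge0// ?exprn_ge0// sumr_ge0// => p _; rewrite exprn_ge0 ?invr_ge0.
  have -> : 10 = 10%:R * 1 :> R by rewrite mulr1.
  rewrite expRM_natl; apply: (@le_trans _ _ (2 ^+ 10)).
    have -> : 2 ^+ 10 = 2 ^+ 8 * 4 :> R by rewrite -!natrX -natrM.
    by rewrite ler_wpM2l.
  by apply: lerXn2r; rewrite ?nnegrE ?expR_ge0// two_le_expR1.
- by move=> y /mapP[z]; rewrite mem_filter => /andP[gz _] ->.
- move=> x x1.
  have [m0|m0] := posnP m.
    have I0 (i : I) : False by have := max_card (pred1 i); rewrite card1 -/m m0.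
    pose z : {ffun I -> bool * 'I_L} := [ffun=> (false, ord0)].
    exists (pt z); last by rewrite /sqnorm big1// => i; case: (I0 i).
    apply/mapP; exists z => //; rewrite mem_filter mem_enum andbT.
    by rewrite /good /sqnorm big1// => i; case: (I0 i).
  have {}sgt0 := sgt0 m0.
  have xs i : 0 <= `|x i| * s by rewrite mulr_ge0.
  (* Rounding towards zero keeps the point in the unit ball; the error is at most [1 / s] per
     coordinate, hence [m / s^2 = 1 / 64] in squared norm. *)
  pose k i := Num.truncn (`|x i| * s).
  have kle i : (k i)%:R <= `|x i| * s by rewrite truncn_le//.
  have kL i : (k i < L)%N.
    rewrite ltnS -(ler_nat R) (le_trans (kle i))//.
    rewrite (@le_trans _ _ s)//.
      by rewrite ler_piMl// coord_norm_le1.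
  pose z : {ffun I -> bool * 'I_L} := [ffun i => (x i < 0, Ordinal (kL i))].
  have ptE i : pt z i = (-1) ^+ (x i < 0)%R * ((k i)%:R / s) by rewrite !ffunE.
  have q0 i : 0 <= (k i)%:R / s by rewrite divr_ge0.
  have qx i : (k i)%:R / s <= `|x i| by rewrite ler_pdivrMr.
  have xq i : `|x i| - (k i)%:R / s <= s^-1.
    rewrite lerBlDl -[X in _ + X]mul1r -mulrDl ler_pdivlMr// natr1 ltW//.
    by have := truncnS_gt (`|x i| * s).
  have gz : good z.
    apply: le_trans x1; apply: ler_sum => i _.
    rewrite ptE exprMn sqrr_sign mul1r -(real_normK (num_real (x i))).
    by apply: lerXn2r; rewrite ?nnegrE.
  exists (pt z).
    by apply/mapP; exists z => //; rewrite mem_filter mem_enum gz.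
  apply: (@le_trans _ _ (\sum_(i : I) (s ^- 2))).
    apply: ler_sum => i _.
    rewrite ptE {1}(numEsign (x i)) -mulrBr exprMn sqrr_sign mul1r -exprVn.
    by apply: lerXn2r; rewrite ?nnegrE ?invr_ge0 ?subr_ge0.
  rewrite sumr_const -/m s2 -[leLHS]mulr_natr.
  have mneq0 : m%:R != 0 :> R by rewrite pnatr_eq0 -lt0n.
  have -> : (64 * m%:R)^-1 * m%:R = 8^-1 ^+ 2 :> R by field.
  by [].
Qed.

(** Replacing the arguments by net points one at a time costs an eighth of the supremum over unit
    balls each time. So [sup S <= B + 3/8 sup S], which gives [sup S <= 2 B]; homogeneity does the
    rest. *)
Lemma trilin_net (I J K : finType) (F : I -> J -> K -> R)
    (NI : seq {ffun I -> R}) (NJ : seq {ffun J -> R}) (NK : seq {ffun K -> R}) (B : R) :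
  (forall x : I -> R, sqnorm x <= 1 ->
     exists2 y, y \in NI & sqnorm (fun i => x i - y i) <= 8^-1 ^+ 2) ->
  (forall x : J -> R, sqnorm x <= 1 ->
     exists2 y, y \in NJ & sqnorm (fun i => x i - y i) <= 8^-1 ^+ 2) ->
  (forall x : K -> R, sqnorm x <= 1 ->
     exists2 y, y \in NK & sqnorm (fun i => x i - y i) <= 8^-1 ^+ 2) ->
  (forall y, y \in NI -> sqnorm y <= 1) -> (forall y, y \in NJ -> sqnorm y <= 1) ->
  0 <= B ->
  (forall w x y, w \in NI -> x \in NJ -> y \in NK -> trilin F w x y <= B) ->
  forall w x y, trilin F w x y <=
    2 * B * (Num.sqrt (sqnorm w) * Num.sqrt (sqnorm x) * Num.sqrt (sqnorm y)).
Proof.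
move=> netI netJ netK NI1 NJ1 B0 netB.
pose S := [set trilin F p.1.1 p.1.2 p.2 | p in
  [set p : (I -> R) * (J -> R) * (K -> R) |
     [/\ sqnorm p.1.1 <= 1, sqnorm p.1.2 <= 1 & sqnorm p.2 <= 1]]].
have SP w x y : sqnorm w <= 1 -> sqnorm x <= 1 -> sqnorm y <= 1 ->
    S (trilin F w x y) by move=> w1 x1 y1; exists (w, x, y).
have sq0 (H : finType) : sqnorm (fun _ : H => 0 : R) <= 1.
  by rewrite /sqnorm big1// => i _; rewrite expr0n.
have Sne : S !=set0 by exists (trilin F (fun=> 0) (fun=> 0) (fun=> 0)); exact: SP.
(* A crude bound suffices: the supremum must be finite to be absorbed on the left. *)
have Sub : has_ubound S.
  exists (\sum_i \sum_j \sum_k `|F i j k|) => _ [[[w x] y] /= [w1 x1 y1] <-].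
  apply: ler_sum => i _; apply: ler_sum => j _; apply: ler_sum => k _.
  apply: le_trans (ler_norm _) _; rewrite !normrM ler_piMl//.
  by rewrite !mulr_ile1// ?mulr_ge0// coord_norm_le1.
have leS w x y : sqnorm w <= 1 -> sqnorm x <= 1 -> sqnorm y <= 1 ->
    trilin F w x y <= sup S.
  by move=> w1 x1 y1; apply: ub_le_sup => //; exact: SP.
have scaled (H : finType) (x : H -> R) : sqnorm x <= 8^-1 ^+ 2 ->
    sqnorm (fun i => 8 * x i) <= 1.
  by rewrite sqnormZ => h; lra.
have step : sup S <= B + 3 / 8 * sup S.
  apply: ge_sup => // _ [[[w x] y] /= [w1 x1 y1] <-].
  have [w' w'N ww'] := netI _ w1; have [x' x'N xx'] := netJ _ x1.
  have [y' y'N yy'] := netK _ y1.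
  have -> : trilin F w x y = trilin F w' x' y' +
      8^-1 * (trilin F (fun i => 8 * (w i - w' i)) x y +
      trilin F w' (fun j => 8 * (x j - x' j)) y +
      trilin F w' x' (fun k => 8 * (y k - y' k))).
    rewrite /trilin -!big_split/= mulr_sumr -!big_split/=; apply: eq_bigr => i _.
    rewrite -!big_split/= mulr_sumr -!big_split/=; apply: eq_bigr => j _.
    rewrite -!big_split/= mulr_sumr -!big_split/=; apply: eq_bigr => k _.
    by field.
  have h0 := netB _ _ _ w'N x'N y'N.
  have h1 := leS _ _ _ (scaled _ _ ww') x1 y1.
  have h2 := leS _ _ _ (NI1 _ w'N) (scaled _ _ xx') y1.
  have h3 := leS _ _ _ (NI1 _ w'N) (NJ1 _ x'N) (scaled _ _ yy').
  by lra.
have S2 : sup S <= 2 * B by lra.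
move=> w x y.
have [/eqP w0|w0] := boolP (sqnorm w == 0).
  suff wz i : w i = 0.
    rewrite w0 sqrtr0 !mul0r mulr0 /trilin big1// => i _.
    by rewrite big1// => j _; rewrite big1// => k _; rewrite wz !mul0r.
  have := coord_sqr_le_sqnorm w i; rewrite w0 => h; apply/eqP.
  by rewrite -sqrf_eq0 eq_le h sqr_ge0.
have [/eqP x0|x0] := boolP (sqnorm x == 0).
  suff xz i : x i = 0.
    rewrite x0 sqrtr0 mulr0 mul0r mulr0 /trilin big1// => i _.
    by rewrite big1// => j _; rewrite big1// => k _; rewrite xz mulr0 !mul0r.
  have := coord_sqr_le_sqnorm x i; rewrite x0 => h; apply/eqP.
  by rewrite -sqrf_eq0 eq_le h sqr_ge0.
have [/eqP y0|y0] := boolP (sqnorm y == 0).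
  suff yz i : y i = 0.
    rewrite y0 sqrtr0 !mulr0 /trilin big1// => i _.
    by rewrite big1// => j _; rewrite big1// => k _; rewrite yz mulr0 !mul0r.
  have := coord_sqr_le_sqnorm y i; rewrite y0 => h; apply/eqP.
  by rewrite -sqrf_eq0 eq_le h sqr_ge0.
have pos (H : finType) (z : H -> R) : sqnorm z != 0 -> 0 < Num.sqrt (sqnorm z).
  by move=> z0; rewrite sqrtr_gt0 lt_neqAle eq_sym z0 sqnorm_ge0.
have unit (H : finType) (z : H -> R) : sqnorm z != 0 ->
    sqnorm (fun i => (Num.sqrt (sqnorm z))^-1 * z i) <= 1.
  by move=> z0; rewrite sqnormZ exprVn sqr_sqrtr ?sqnorm_ge0// mulVf.
have := le_trans (leS _ _ _ (unit _ _ w0) (unit _ _ x0) (unit _ _ y0)) S2.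
move: (pos _ _ w0) (pos _ _ x0) (pos _ _ y0).
set a := Num.sqrt (sqnorm w); set b := Num.sqrt (sqnorm x).
set c := Num.sqrt (sqnorm y) => a0 b0 c0.
have -> : trilin F (fun i => a^-1 * w i) (fun i => b^-1 * x i) (fun i => c^-1 * y i) =
    trilin F w x y / (a * b * c).
  rewrite /trilin mulr_suml; apply: eq_bigr => i _; rewrite mulr_suml.
  apply: eq_bigr => j _; rewrite mulr_suml; apply: eq_bigr => k _.
  by field; rewrite !gt_eqF.
by rewrite ler_pdivrMr// !mulr_gt0.
Qed.

End euclidean.

(** * The off-diagonal chaos *)

(** Duality: testing the trilinear form against the vector [z] of slices itself gives
    [|z|^2 <= B |z| |x| |y|]. *)
Lemma slice_bound (R : realType) (I J K : finType) (F : I -> J -> K -> R) (B : R) :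
  0 <= B ->
  (forall w x y, trilin F w x y <=
    B * (Num.sqrt (sqnorm w) * Num.sqrt (sqnorm x) * Num.sqrt (sqnorm y))) ->
  forall x y, \sum_i (\sum_j \sum_k x j * y k * F i j k) ^+ 2 <=
    B ^+ 2 * (sqnorm x * sqnorm y).
Proof.
move=> B0 FB x y.
pose z i := \sum_j \sum_k x j * y k * F i j k.
have zE : sqnorm z = trilin F z x y.
  rewrite /sqnorm /trilin; apply: eq_bigr => i _.
  rewrite expr2 {2}/z mulr_sumr; apply: eq_bigr => j _; rewrite mulr_sumr.
  by apply: eq_bigr => k _; rewrite !mulrA.
rewrite -/(sqnorm z).
have := FB z x y; rewrite -zE.
have := sqr_sqrtr (sqnorm_ge0 z); have := sqr_sqrtr (sqnorm_ge0 x).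
have := sqr_sqrtr (sqnorm_ge0 y).
have := sqrtr_ge0 (sqnorm z); have := sqrtr_ge0 (sqnorm x); have := sqrtr_ge0 (sqnorm y).
set s := Num.sqrt (sqnorm z); set p := Num.sqrt (sqnorm x).
set q := Num.sqrt (sqnorm y) => q0 p0 s0 <- <- <- h.
rewrite -!exprMn lerXn2r ?nnegrE ?mulr_ge0//.
have [->|sn0] := eqVneq s 0; first by rewrite !mulr_ge0.
have sgt0 : 0 < s by rewrite lt_neqAle eq_sym sn0.
by rewrite -(ler_pM2l sgt0); move: h; rewrite expr2; nra.
Qed.

Lemma sum_pair (V : nmodType) (I J : finType) (f : I * J -> V) :
  \sum_p f p = \sum_i \sum_j f (i, j).
Proof. by rewrite pair_bigA /=; apply: eq_bigr => -[i j] _. Qed.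

Lemma sum_triple (V : nmodType) (I J K : finType) (f : I * J * K -> V) :
  \sum_t f t = \sum_i \sum_j \sum_k f (i, j, k).
Proof. by rewrite !sum_pair. Qed.

Lemma sum_unit (R : realType) (f : unit -> R) : \sum_u f u = f tt.
Proof. by rewrite (eq_bigl (pred1 tt)) ?big_pred1_eq// => u; case: u. Qed.

(** A bilinear form is treated as a trilinear one with a one-point first factor, so that
    [trilin_net] serves both net arguments. *)
Lemma trilin_unit (R : realType) (J K : finType) (G : J -> K -> R)
    (w : unit -> R) (x : J -> R) (y : K -> R) :
  trilin (fun=> G) w x y = w tt * \sum_j \sum_k x j * y k * G j k.
Proof.
rewrite /trilin sum_unit.
rewrite mulr_sumr; apply: eq_bigr => j _; rewrite mulr_sumr.
by apply: eq_bigr => k _; rewrite !mulrA.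
Qed.

Lemma sqnorm_unit (R : realType) (w : unit -> R) : sqnorm w = w tt ^+ 2.
Proof. exact: sum_unit. Qed.

Lemma size_allpairs3 (S1 S2 S3 : eqType) (s1 : seq S1) (s2 : seq S2) (s3 : seq S3) :
  size [seq (p, z) | p <- [seq (x, y) | x <- s1, y <- s2], z <- s3] =
  (size s1 * size s2 * size s3)%N.
Proof. by rewrite !size_allpairs. Qed.

Section coupling.
Context (R : realType) (n : nat).
Implicit Types (a : 'I_n -> 'I_n -> 'I_n -> R) (U V : 'I_n * 'I_n -> R).

(** The restriction to [p.1 < p.2] makes [a i p.2 q.2] the later factor of each product in the order
    of the second tensor index. *)
Definition lower_coupling a (p q : 'I_n * 'I_n) : R :=
  if (p.1 < p.2)%N then \sum_i a i p.1 q.1 * a i p.2 q.2 else 0.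

(** The coefficient of the entry [a i b d] in the chaos, made of entries of second index below
    [b]. *)
Let coef a U V (i b d : 'I_n) : R :=
  \sum_(j < n) \sum_(k < n) (if (j < b)%N then U (j, b) else 0) * V (k, d) * a i j k.

Lemma sum_coef_lower_coupling a U V :
  \sum_i \sum_b \sum_d coef a U V i b d * a i b d =
  \sum_p \sum_q U p * V q * lower_coupling a p q.
Proof.
pose t (i b d j k : 'I_n) :=
  (if (j < b)%N then U (j, b) else 0) * V (k, d) * a i j k * a i b d.
transitivity (\sum_i \sum_b \sum_d \sum_j \sum_k t i b d j k).
  apply: eq_bigr => i _; apply: eq_bigr => b _; apply: eq_bigr => d _.
  by rewrite mulr_suml; apply: eq_bigr => j _; rewrite mulr_suml.
transitivity (\sum_j \sum_b \sum_k \sum_d \sum_i t i b d j k); last first.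
  rewrite sum_pair.
  apply: eq_bigr => j _; apply: eq_bigr => b _.
  rewrite sum_pair.
  apply: eq_bigr => k _; apply: eq_bigr => d _; rewrite /lower_coupling /t /=.
  case: ifP => _; last by rewrite mulr0 big1// => i _; rewrite !mul0r.
  by rewrite mulr_sumr; apply: eq_bigr => i _; rewrite !mulrA.
transitivity (\sum_i \sum_j \sum_b \sum_k \sum_d t i b d j k).
  apply: eq_bigr => i _; rewrite [RHS]exchange_big/=; apply: eq_bigr => b _.
  rewrite exchange_big/=; apply: eq_bigr => j _; exact: exchange_big.
rewrite exchange_big/=; apply: eq_bigr => j _.
rewrite exchange_big/=; apply: eq_bigr => b _.
rewrite exchange_big/=; apply: eq_bigr => k _.
exact: exchange_big.
Qed.

(** Quadratic variation: for fixed [b] and [d] the sum over [i] is a slice at the truncated column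
    [b] of [U] and the column [d] of [V]. Summing [slice_bound] over columns gives Frobenius norms,
    which truncation only decreases. *)
Lemma sum_coef_sqr a U V (B : R) : 0 <= B ->
  (forall w x y, trilin a w x y <=
    B * (Num.sqrt (sqnorm w) * Num.sqrt (sqnorm x) * Num.sqrt (sqnorm y))) ->
  \sum_i \sum_b \sum_d coef a U V i b d ^+ 2 <= B ^+ 2 * (sqnorm U * sqnorm V).
Proof.
move=> B0 aB.
pose x (b j : 'I_n) := if (j < b)%N then U (j, b) else 0.
pose y (d k : 'I_n) := V (k, d).
have -> : \sum_i \sum_b \sum_d coef a U V i b d ^+ 2 =
          \sum_b \sum_d \sum_i (\sum_j \sum_k x b j * y d k * a i j k) ^+ 2.
  by rewrite exchange_big/=; apply: eq_bigr => b _; exact: exchange_big.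
apply: (@le_trans _ _ (\sum_b \sum_d B ^+ 2 * (sqnorm (x b) * sqnorm (y d)))).
  by apply: ler_sum => b _; apply: ler_sum => d _; exact: slice_bound.
have -> : \sum_b \sum_d B ^+ 2 * (sqnorm (x b) * sqnorm (y d)) =
          B ^+ 2 * ((\sum_b sqnorm (x b)) * (\sum_d sqnorm (y d))).
  rewrite mulr_suml mulr_sumr; apply: eq_bigr => b _.
  by rewrite mulr_sumr mulr_sumr.
rewrite ler_wpM2l ?sqr_ge0//; apply: ler_pM.
- by apply: sumr_ge0 => b _; exact: sqnorm_ge0.
- by apply: sumr_ge0 => b _; exact: sqnorm_ge0.
- rewrite [leRHS]sum_pair exchange_big/=.
  apply: ler_sum => j _; apply: ler_sum => b _; rewrite /x.
  by case: ifP => // _; rewrite expr0n/= sqr_ge0.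
- by rewrite [leRHS]sum_pair exchange_big.
Qed.

End coupling.

(** * High-probability events for the injective norm and the chaos *)

Section good_event.
Context (R : realType) (n : nat) (d : measure_display) (T : measurableType d).
Variables (P : probability T R) (A : 'I_n * 'I_n * 'I_n -> {RV P >-> R}).
Hypotheses (n_gt0 : (0 < n)%N) (indepA : mutually_independent A)
  (normA : forall t, std_normal (A t)).

Let a w i j k : R := A (i, j, k) w.

(* The second tensor index is the most significant digit: the coefficients of
   the quadratic chaos at an entry only involve entries of smaller second index. *)
Let rank (t : 'I_n * 'I_n * 'I_n) : nat := (t.1.2 * n + t.1.1) * n + t.2.

Let rank_inj : injective rank.
Proof.
move=> [[i j] k] [[i' j'] k'] /eqP; rewrite /rank /= eq_addl_mul// => /eqP[].
by move=> /eqP; rewrite eq_addl_mul// => /eqP[] /val_inj -> /val_inj -> /val_inj ->.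
Qed.

Let rank_lt (s t : 'I_n * 'I_n * 'I_n) : (s.1.2 < t.1.2)%N -> (rank s < rank t)%N.
Proof.
move=> st; rewrite /rank.
have h1 : ((s.1.2 * n + s.1.1).+1 <= t.1.2 * n + t.1.1)%N.
  rewrite (@leq_trans (s.1.2.+1 * n))//; first by rewrite mulSn addnC ltn_add2r.
  by rewrite (leq_trans (leq_mul st (leqnn n)))// leq_addr.
rewrite (@leq_trans ((s.1.2 * n + s.1.1).+1 * n))//.
  by rewrite mulSn addnC ltn_add2r.
by rewrite (leq_trans (leq_mul h1 (leqnn n)))// leq_addr.
Qed.

Let exponent (al : 'I_n * 'I_n * 'I_n -> R)
    (ka : 'I_n * 'I_n * 'I_n -> 'I_n * 'I_n * 'I_n -> R) (w : T) : R :=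
  \sum_t ((al t + \sum_(s | (rank s < rank t)%N) ka t s * A s w) * A t w
   - (al t + \sum_(s | (rank s < rank t)%N) ka t s * A s w) ^+ 2 / 2).

Let sn : R := Num.sqrt n%:R.
Let sn2 : sn ^+ 2 = n%:R. Proof. by rewrite sqr_sqrtr. Qed.
Let sn_gt0 : 0 < sn. Proof. by rewrite sqrtr_gt0 ltr0n. Qed.

Lemma injective_norm_event : exists E : set T, [/\ measurable E,
    (P (~` E) <= (expR (- (10 * n%:R)))%:E)%E
  & forall w, E w -> forall u x y, trilin (a w) u x y <=
      20 * sn * (Num.sqrt (sqnorm u) * Num.sqrt (sqnorm x) * Num.sqrt (sqnorm y))].
Proof.
have [N [Nsize N1 Nnet]] := ball_net R 'I_n.
pose V := {ffun 'I_n -> R}.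
(* A deterministic tilt. On the net, [8 sn * trilin <= 40 n + 32 n = 8 sn * 9 sn]; the level 40 n
   beats the three nets, of total size at most [expR (30 n)]. *)
pose al (q : V * V * V) (t : 'I_n * 'I_n * 'I_n) : R :=
  8 * sn * (q.1.1 t.1.1 * q.1.2 t.1.2 * q.2 t.2).
have [E [mE PE HE]] := @exponential_union_bound _ _ _ P _
  [seq (p, z) | p <- [seq (x, y) | x <- N, y <- N], z <- N]
  (fun q : V * V * V => exponent (al q) (fun _ _ => 0)) (40 * n%:R)
  (fun q => measurable_martingale_exponent _ _ _ (fun t => measurable_funPT (A t)))
  (fun q => integral_expR_martingale indepA normA _ _ rank_inj).
exists E; split=> //.
  apply: le_trans PE _; rewrite lee_fin size_allpairs3 !natrM.
  rewrite card_ord in Nsize.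
  rewrite (_ : - (10 * n%:R) = 10 * n%:R + 10 * n%:R + 10 * n%:R - 40 * n%:R); last by ring.
  by rewrite !expRD ler_wpM2r ?expR_ge0// !ler_pM ?mulr_ge0.
move=> w Ew u x y.
rewrite (_ : 20 * sn = 2 * (10 * sn)); last by ring.
apply: (trilin_net Nnet Nnet Nnet N1 N1); first by rewrite mulr_ge0// ltW.
move=> {}u {}x {}y uN xN yN.
have := HE _ Ew (u, x, y); rewrite allpairs_f ?allpairs_f// => /(_ isT).
rewrite /exponent.
have -> : \sum_t ((al (u, x, y) t + \sum_(s | (rank s < rank t)%N) 0 * A s w) * A t w
   - (al (u, x, y) t + \sum_(s | (rank s < rank t)%N) 0 * A s w) ^+ 2 / 2) =
   8 * sn * trilin (a w) u x y - 32 * n%:R * (sqnorm u * sqnorm x * sqnorm y).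
  have cE t : al (u, x, y) t + \sum_(s | (rank s < rank t)%N) 0 * A s w = al (u, x, y) t.
    by rewrite big1 ?addr0// => s _; rewrite mul0r.
  under eq_bigr do rewrite cE.
  rewrite sumrB; congr (_ - _).
    rewrite sum_triple /trilin !mulr_sumr; apply: eq_bigr => i _.
    rewrite !mulr_sumr; apply: eq_bigr => j _; rewrite !mulr_sumr.
    by apply: eq_bigr => k _; rewrite /al /a /= !mulrA.
  have -> : sqnorm u * sqnorm x * sqnorm y =
      \sum_i \sum_j \sum_k u i ^+ 2 * (x j ^+ 2 * y k ^+ 2).
    rewrite -mulrA mulr_suml; apply: eq_bigr => i _.
    rewrite mulr_suml mulr_sumr; apply: eq_bigr => j _.
    by rewrite mulr_sumr mulr_sumr.
  rewrite sum_triple mulr_sumr; apply: eq_bigr => i _.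
  rewrite mulr_sumr; apply: eq_bigr => j _.
  rewrite mulr_sumr; apply: eq_bigr => k _.
  by rewrite /al /= !exprMn sn2; field.
have : sqnorm u * sqnorm x * sqnorm y <= 1.
  by rewrite !mulr_ile1 ?mulr_ge0 ?sqnorm_ge0 ?N1.
rewrite -sn2 => h1 h2.
have : 8 * sn * trilin (a w) u x y <= 8 * sn * (9 * sn) by nra.
rewrite ler_pM2l ?mulr_gt0//; have := sn_gt0; lra.
Qed.

(** The quadratic variation is random, but the exponential martingale subtracts it and has mean 1
    regardless. The injective norm bound can thus remain a hypothesis on the individual outcome [w],
    used only after the union bound. *)
Lemma lower_coupling_event : exists E : set T, [/\ measurable E,
    (P (~` E) <= (expR (- (10 * n%:R)))%:E)%E
  & forall w, E w ->
     (forall u x y, trilin (a w) u x y <=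
      20 * sn * (Num.sqrt (sqnorm u) * Num.sqrt (sqnorm x) * Num.sqrt (sqnorm y))) ->
     forall U V : 'I_n * 'I_n -> R,
       \sum_p \sum_q U p * V q * lower_coupling (a w) p q <=
       400 * (n%:R * sn) * (Num.sqrt (sqnorm U) * Num.sqrt (sqnorm V))].
Proof.
have [N [Nsize N1 Nnet]] := ball_net R ('I_n * 'I_n)%type.
have [N' [N'size N'1 N'net]] := ball_net R unit.
pose VT := {ffun 'I_n * 'I_n -> R}; pose VT' := {ffun unit -> R}.
(* With tilt [sn / 2] and variation at most [400 n], the exponent bound reads
   [sn / 2 * Z <= 40 n^2 + 50 n^2], that is [Z <= 180 n sn], below the level [200 n sn] that the net
   argument doubles. *)
pose ka (q : VT' * VT * VT) (t s : 'I_n * 'I_n * 'I_n) : R :=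
  if (s.1.1 == t.1.1) && (s.1.2 < t.1.2)%N
  then sn / 2 * q.1.1 tt * (q.1.2 (s.1.2, t.1.2) * q.2 (s.2, t.2)) else 0.
have [E [mE PE HE]] := @exponential_union_bound _ _ _ P _
  [seq (p, z) | p <- [seq (x, y) | x <- N', y <- N], z <- N]
  (fun q : VT' * VT * VT => exponent (fun=> 0) (ka q)) (40 * n%:R ^+ 2)
  (fun q => measurable_martingale_exponent _ _ _ (fun t => measurable_funPT (A t)))
  (fun q => integral_expR_martingale indepA normA _ _ rank_inj).
have n1 : 1 <= n%:R :> R by rewrite ler1n.
exists E; split=> //.
  apply: le_trans PE _; rewrite lee_fin size_allpairs3 !natrM.
  rewrite card_prod card_ord natrM -expr2 in Nsize; rewrite card_unit mulr1 in N'size.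
  apply: (@le_trans _ _ (expR (10 + 10 * n%:R ^+ 2 + 10 * n%:R ^+ 2 - 40 * n%:R ^+ 2))).
    rewrite expRD (expRD (10 + _)) (expRD 10).
    by rewrite ler_wpM2r ?expR_ge0// !ler_pM ?mulr_ge0.
  by rewrite ler_expR; nra.
move=> w Ew aK U0 V0.
have := @trilin_net _ _ _ _ (fun=> lower_coupling (a w)) _ _ _ (200 * (n%:R * sn))
  N'net Nnet Nnet N'1 N1 _ _ (fun=> 1) U0 V0.
rewrite trilin_unit mul1r sqnorm_unit expr1n sqrtr1 mul1r.
rewrite (_ : 2 * (200 * (n%:R * sn)) = 400 * (n%:R * sn)); last by ring.
apply; first by rewrite !mulr_ge0// ltW.
move=> u {}U {}V uN UN VN.
have := HE _ Ew (u, U, V); rewrite allpairs_f ?allpairs_f// => /(_ isT).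
pose c (i b e : 'I_n) := \sum_(j < n) \sum_(k < n)
  (if (j < b)%N then U (j, b) else 0) * V (k, e) * a w i j k.
(* The constraint on ranks loses nothing: by [rank_lt] every entry with [j < b] has smaller rank. *)
have cE i b e : 0 + \sum_(s | (rank s < rank (i, b, e))%N) ka (u, U, V) (i, b, e) s * A s w
    = sn / 2 * u tt * c i b e.
  rewrite add0r big_mkcond sum_triple (bigD1 i)//= [X in _ + X]big1 ?addr0; last first.
    move=> i' /negbTE i'i; rewrite big1// => j _; rewrite big1// => k _.
    by case: ifP => // _; rewrite /ka /= i'i mul0r.
  rewrite mulr_sumr; apply: eq_bigr => j _; rewrite mulr_sumr.
  apply: eq_bigr => k _; rewrite /ka /= eqxx /=.
  have [jb|jb] := boolP (j < b)%N; last by rewrite !mul0r mulr0; case: ifP.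
  by rewrite rank_lt// /a !mulrA.
have -> : exponent (fun=> 0) (ka (u, U, V)) w =
    sn / 2 * (u tt * (\sum_p \sum_q U p * V q * lower_coupling (a w) p q)) -
    n%:R / 8 * (u tt ^+ 2 * (\sum_i \sum_b \sum_e c i b e ^+ 2)).
  rewrite -sum_coef_lower_coupling /exponent sumrB; congr (_ - _).
    rewrite sum_triple !mulr_sumr; apply: eq_bigr => i _.
    rewrite !mulr_sumr; apply: eq_bigr => b _; rewrite !mulr_sumr.
    by apply: eq_bigr => e _; rewrite cE /c /a !mulrA.
  rewrite sum_triple !mulr_sumr; apply: eq_bigr => i _.
  rewrite !mulr_sumr; apply: eq_bigr => b _; rewrite !mulr_sumr.
  by apply: eq_bigr => e _; rewrite cE !exprMn sn2; field.
rewrite trilin_unit; set Z := u tt * _.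
have h1 : \sum_i \sum_b \sum_e c i b e ^+ 2 <= 400 * n%:R.
  apply: (le_trans (sum_coef_sqr _ _ _ aK)); first by rewrite mulr_ge0// ltW.
  rewrite exprMn sn2 -[leRHS]mulr1 -natrX ler_wpM2l ?mulr_ge0//.
  by rewrite mulr_ile1 ?sqnorm_ge0 ?N1.
have c0 : 0 <= \sum_i \sum_b \sum_e c i b e ^+ 2.
  by do 3 (apply: sumr_ge0 => ? _); rewrite sqr_ge0.
have u1 : u tt ^+ 2 <= 1 by rewrite -sqnorm_unit N'1.
have h2 : u tt ^+ 2 * (\sum_i \sum_b \sum_e c i b e ^+ 2) <= 400 * n%:R.
  by rewrite -[leRHS]mul1r ler_pM ?sqr_ge0.
move=> h3.
have h4 : n%:R / 8 * (u tt ^+ 2 * (\sum_i \sum_b \sum_e c i b e ^+ 2)) <=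
   n%:R / 8 * (400 * n%:R) by rewrite ler_wpM2l// divr_ge0.
have : sn / 2 * Z <= sn / 2 * (180 * (n%:R * sn)).
  rewrite (_ : sn / 2 * (180 * (n%:R * sn)) = 90 * n%:R * sn ^+ 2); last by field.
  rewrite sn2; lra.
rewrite ler_pM2l ?divr_gt0// => h5; apply: le_trans h5 _.
have : 0 <= n%:R * sn by rewrite mulr_ge0// ltW.
by lra.
Qed.

End good_event.

(** * The certificate *)

Section certificate.
Context (R : realType) (n : nat).
Variables (a : 'I_n -> 'I_n -> 'I_n -> R) (lam : R).

(** The entries of [sum_i A_i (x) A_i], rows and columns indexed by pairs. *)
Definition kron_sum (p q : 'I_n * 'I_n) : R := \sum_i a i p.1 q.1 * a i p.2 q.2.

(* [lam ^ 2 M - sum_i A_i (x) A_i], where [lam ^ 2 M] is [lam ^ 2] times the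
   identity plus the diagonal blocks [p.1 = p.2] of [sum_i A_i (x) A_i] minus
   the same coefficients moved to the positions [p.1 = q.1]. *)
Definition certificate (p q : 'I_n * 'I_n) : R :=
  lam ^+ 2 * (p == q)%:R
  - (p.1 == q.1)%:R * (\sum_i a i p.1 p.2 * a i p.1 q.2)
  - (p.1 != p.2)%:R * kron_sum p q.

Lemma sum_delta (I : finType) (x0 : I) (f : I -> R) :
  \sum_x (x0 == x)%:R * f x = f x0.
Proof.
rewrite (bigD1 x0)//= eqxx mul1r big1 ?addr0// => x /negbTE h.
by rewrite eq_sym h mul0r.
Qed.

(** The form splits into [lam^2 |u|^2], the moved diagonal blocks, a sum of squares costing at most
    [K^2 |u|^2], and two chaos terms costing at most [B |u|^2] each. *)
Lemma certificate_ge0 (K B : R) : 0 <= K ->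
  (forall w x y, trilin a w x y <=
    K * (Num.sqrt (sqnorm w) * Num.sqrt (sqnorm x) * Num.sqrt (sqnorm y))) ->
  (forall U V : 'I_n * 'I_n -> R,
    \sum_p \sum_q U p * V q * lower_coupling a p q <=
    B * (Num.sqrt (sqnorm U) * Num.sqrt (sqnorm V))) ->
  K ^+ 2 + 2 * B <= lam ^+ 2 ->
  forall u : 'I_n * 'I_n -> R, 0 <= \sum_p \sum_q u p * u q * certificate p q.
Proof.
move=> K0 aK aB lamKB u.
pose sw (p : 'I_n * 'I_n) := (p.2, p.1).
have swK : involutive sw by case.
(* Swapping both pairs leaves [kron_sum] unchanged, so the part [p.1 > p.2] is the lower part
   evaluated at the transpose of [u]. *)
have kronE p q : (p.1 != p.2)%:R * kron_sum p q =
    lower_coupling a p q + lower_coupling a (sw p) (sw q).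
  rewrite /lower_coupling /kron_sum /=.
  have [p12|p12|p12] := ltngtP p.1 p.2.
  - by rewrite (_ : _ != _) ?mul1r ?addr0// -val_eqE neq_ltn p12.
  - rewrite (_ : _ != _) ?mul1r ?add0r; last by rewrite -val_eqE neq_ltn p12 orbT.
    by apply: eq_bigr => i _; rewrite mulrC.
  - by rewrite (val_inj p12) eqxx mul0r addr0.
have -> : \sum_p \sum_q u p * u q * certificate p q =
    lam ^+ 2 * sqnorm u
    - \sum_x \sum_i (\sum_y u (x, y) * a i x y) ^+ 2
    - (\sum_p \sum_q u p * u q * lower_coupling a p q
       + \sum_p \sum_q u (sw p) * u (sw q) * lower_coupling a p q).
  transitivity (\sum_p (u p * lam ^+ 2 * u p
    - \sum_q u p * u q * ((p.1 == q.1)%:R * (\sum_i a i p.1 p.2 * a i p.1 q.2))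
    - (\sum_q u p * u q * lower_coupling a p q +
       \sum_q u p * u q * lower_coupling a (sw p) (sw q)))).
    apply: eq_bigr => p _.
    rewrite -(sum_delta p (fun q => u p * lam ^+ 2 * u q)) -big_split/= -!sumrB.
    by apply: eq_bigr => q _; rewrite /certificate kronE; ring.
  rewrite !sumrB big_split/=; congr (_ - _ - (_ + _)).
  - by rewrite /sqnorm mulr_sumr; apply: eq_bigr => p _; ring.
  - rewrite sum_pair; apply: eq_bigr => x _.
    transitivity (\sum_y \sum_z \sum_i (u (x, y) * a i x y) * (u (x, z) * a i x z)).
      apply: eq_bigr => y _; rewrite sum_pair /= exchange_big/=.
      apply: eq_bigr => z _.
      rewrite (eq_bigr (fun x' => (x == x')%:R *
        (u (x, y) * u (x', z) * (\sum_i a i x y * a i x z)))); last first.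
        by move=> x' _; ring.
      rewrite sum_delta mulr_sumr; apply: eq_bigr => i _; ring.
    transitivity (\sum_i \sum_y \sum_z (u (x, y) * a i x y) * (u (x, z) * a i x z)).
      rewrite [RHS]exchange_big/=; apply: eq_bigr => y _; exact: exchange_big.
    apply: eq_bigr => i _; rewrite expr2 mulr_suml; apply: eq_bigr => y _.
    by rewrite mulr_sumr.
  - rewrite (reindex_inj (inv_inj swK))/=; apply: eq_bigr => p _.
    rewrite (reindex_inj (inv_inj swK))/=; apply: eq_bigr => q _.
    by rewrite !swK.
(* For each [x], [slice_bound] at the basis vector of index [x] and the row [x] of [u]. *)
have h1 : \sum_x \sum_i (\sum_y u (x, y) * a i x y) ^+ 2 <= K ^+ 2 * sqnorm u.
  rewrite /sqnorm sum_pair mulr_sumr; apply: ler_sum => x _.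
  have := slice_bound K0 aK (fun j => (x == j)%:R) (fun y => u (x, y)).
  have -> : sqnorm (fun j : 'I_n => (x == j)%:R : R) = 1.
    rewrite /sqnorm (eq_bigr (fun j => (x == j)%:R * 1)) ?sum_delta// => j _.
    by case: eqP; rewrite ?expr1n ?expr0n ?mulr1.
  rewrite mul1r; apply: le_trans; rewrite le_eqVlt; apply/orP; left; apply/eqP.
  apply: eq_bigr => i _; congr (_ ^+ 2).
  rewrite [RHS](eq_bigr (fun j => (x == j)%:R * \sum_k u (x, k) * a i j k)) ?sum_delta//.
  by move=> j _; rewrite mulr_sumr; apply: eq_bigr => k _; rewrite mulrA.
have h2 := aB u u.
have h3 := aB (u \o sw) (u \o sw).
have usw : sqnorm (u \o sw) = sqnorm u.
  rewrite /sqnorm (reindex_inj (inv_inj swK))/=.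
  by apply: eq_bigr => p _; rewrite swK.
rewrite usw -expr2 sqr_sqrtr ?sqnorm_ge0// in h3.
rewrite -expr2 sqr_sqrtr ?sqnorm_ge0// in h2.
have := ler_wpM2r (sqnorm_ge0 u) lamKB.
move: h3 => /=; lra.
Qed.

(** Exchanging the two middle indices matches the diagonal blocks with their moved copies, so they
    cancel. An abstract [mu] covers both the values at a point and pseudo-moments. *)
Lemma certificate_moment (mu : 'I_n -> 'I_n -> 'I_n -> 'I_n -> R) :
  (forall x y z t, mu x y z t = mu x z y t) ->
  \sum_p \sum_q mu p.1 p.2 q.1 q.2 * (certificate p q + kron_sum p q) =
  lam ^+ 2 * \sum_x \sum_y mu x x y y.
Proof.
move=> muC.
transitivity (\sum_p \sum_q (
    lam ^+ 2 * ((p == q)%:R * mu p.1 p.2 q.1 q.2)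
  - (p.1 == q.1)%:R * (mu p.1 p.2 q.1 q.2 * \sum_i a i p.1 p.2 * a i p.1 q.2)
  + (p.1 == p.2)%:R * (mu p.1 p.2 q.1 q.2 * kron_sum p q))).
  apply: eq_bigr => p _; apply: eq_bigr => q _; rewrite /certificate.
  by case: (p.1 == p.2) => /=; ring.
under eq_bigr do rewrite big_split/= sumrB.
rewrite big_split/= sumrB -[RHS]addr0 -addrA; congr (_ + _).
  rewrite mulr_sumr sum_pair; apply: eq_bigr => x _.
  rewrite mulr_sumr; apply: eq_bigr => y _; rewrite -mulr_sumr sum_delta/=.
  by rewrite muC.
apply/eqP; rewrite addrC subr_eq0; apply/eqP.
transitivity (\sum_x \sum_y \sum_z
   mu x x y z * \sum_i a i x y * a i x z).
  rewrite sum_pair; apply: eq_bigr => x _ /=.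
  rewrite (eq_bigr (fun y => (x == y)%:R * \sum_q (mu x y q.1 q.2 * kron_sum (x, y) q))).
    by rewrite sum_delta sum_pair.
  by move=> y _; rewrite mulr_sumr.
rewrite [RHS]sum_pair; apply: eq_bigr => x _; apply: eq_bigr => y _ /=.
rewrite sum_pair exchange_big /=; apply: eq_bigr => z _.
by rewrite sum_delta muC.
Qed.

Lemma lambda_bounded_certificate : lam != 0 ->
  (forall u : 'I_n * 'I_n -> R, 0 <= \sum_p \sum_q u p * u q * certificate p q) ->
  lambda_bounded (tensor_poly a) lam.
Proof.
move=> lam0 cert_ge0.
pose A i : 'M[R]_n := \matrix_(j, k) a i j k.
pose un (x : 'I_(n * n)) := mxtens_unindex x.
pose Q : 'M[R]_(n * n) := \matrix_(x, y) certificate (un x) (un y).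
have sum_un (f : 'I_n * 'I_n -> R) : \sum_(x < n * n) f (un x) = \sum_p f p.
  rewrite (reindex (@mxtens_index n n))/=.
    by apply: eq_bigr => p _; rewrite /un mxtens_indexK.
  by exists un => p _; rewrite /un ?mxtens_indexK ?mxtens_unindexK.
have dotE m (v : 'cV[R]_m) (M : 'M[R]_m) :
    dotv v (M *m v) = \sum_x \sum_y v x 0 * v y 0 * M x y.
  rewrite /dotv mxE; apply: eq_bigr => x _; rewrite !mxE mulr_sumr.
  by apply: eq_bigr => y _; ring.
have dot_un (v : 'cV[R]_(n * n)) (f : 'I_n * 'I_n -> 'I_n * 'I_n -> R) :
    dotv v ((\matrix_(x, y) f (un x) (un y)) *m v) =
    \sum_p \sum_q v (mxtens_index p) 0 * v (mxtens_index q) 0 * f p q.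
  rewrite dotE -sum_un; apply: eq_bigr => x _; rewrite -sum_un.
  by apply: eq_bigr => y _; rewrite /un !mxtens_unindexK !mxE.
have sumA : \sum_i A i *t A i = \matrix_(x, y) kron_sum (un x) (un y).
  apply/matrixP => x y; rewrite summxE mxE; apply: eq_bigr => i _.
  by rewrite !mxE.
(* Chosen so that [lam^2 M - sum_i A_i (x) A_i] is exactly the certificate matrix [Q]. *)
exists A, (lam ^- 2 *: (Q + \sum_i A i *t A i)); split.
- move=> x; rewrite /tensor_poly raddf_sum; apply: eq_bigr => i _ /=.
  rewrite dotE mulr_sumr raddf_sum; apply: eq_bigr => j _ /=.
  rewrite mulr_sumr raddf_sum; apply: eq_bigr => k _ /=.
  by rewrite mevalZ !mevalM !mevalXU !mxE; ring.
- move=> x; rewrite sumA -scalemxAl.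
  have -> : Q + \matrix_(i, j) kron_sum (un i) (un j) =
      \matrix_(i, j) (certificate (un i) (un j) + kron_sum (un i) (un j)).
    by apply/matrixP => i j; rewrite !mxE.
  have -> v : dotv v (lam ^- 2 *: ((\matrix_(i, j) (certificate (un i) (un j)
        + kron_sum (un i) (un j))) *m v)) =
      lam ^- 2 * dotv v ((\matrix_(i, j) (certificate (un i) (un j)
        + kron_sum (un i) (un j))) *m v).
    by rewrite /dotv -scalemxAr mxE.
  rewrite (dot_un _ (fun p q => certificate p q + kron_sum p q)).
  pose mu i j k l := x i 0 * x j 0 * (x k 0 * x l 0).
  rewrite (eq_bigr (fun p => \sum_q mu p.1 p.2 q.1 q.2 *
    (certificate p q + kron_sum p q))); last first.
    by move=> p _; apply: eq_bigr => q _; rewrite !mxE !mxtens_indexK /= !ord1.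
  rewrite certificate_moment; last by move=> i j k l; rewrite /mu; ring.
  rewrite mulrA mulVf ?mul1r ?expf_neq0// expr2 mulr_suml.
  by apply: eq_bigr => i _; rewrite mulr_sumr; apply: eq_bigr => j _; rewrite /mu; ring.
- move=> u; rewrite scalerA divff ?expf_neq0// scale1r addrK.
  by rewrite (dot_un _ certificate); exact: cert_ge0.
Qed.

End certificate.

(** * Pairing of positive semidefinite forms *)

Section psd.
Context (R : realType) (I : finType).

Lemma sum_indicator (x0 : I) (f : I -> R) : \sum_x (x == x0)%:R * f x = f x0.
Proof.
by rewrite -(sum_delta x0 f); apply: eq_bigr => x _; rewrite eq_sym.
Qed.

(* Symmetric elimination of the indices of [s] one after the other; a vanishing
   pivot [Q i0 i0] needs no special treatment because then [_ / Q i0 i0 = 0]. *)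
Lemma psd_inner_sym (mu : I -> I -> R) :
  (forall u : I -> R, 0 <= \sum_i \sum_j u i * u j * mu i j) ->
  forall (s : seq I) (Q : I -> I -> R), (forall i j, Q i j = Q j i) ->
  (forall u : I -> R, 0 <= \sum_i \sum_j u i * u j * Q i j) ->
  (forall i j, i \notin s -> Q i j = 0) ->
  0 <= \sum_i \sum_j Q i j * mu i j.
Proof.
move=> mu0; elim=> [|i0 s IH] Q Qsym Q0 Qs.
  by rewrite big1// => i _; rewrite big1// => j _; rewrite Qs// mul0r.
pose r := (Q i0 i0)^-1.
pose Q' i j := Q i j - r * (Q i0 i * Q i0 j).
have quad c (u : I -> R) : \sum_i \sum_j (u i - c * (i == i0)%:R) *
      (u j - c * (j == i0)%:R) * Q i j =
    \sum_i \sum_j u i * u j * Q i j - 2 * c * (\sum_j u j * Q i0 j)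
      + c ^+ 2 * Q i0 i0.
  transitivity (\sum_i (\sum_j u i * u j * Q i j - c * (u i * Q i0 i)
     - (i == i0)%:R * (c * \sum_j u j * Q i j - c ^+ 2 * Q i0 i))).
    apply: eq_bigr => i _.
    rewrite -[c * (u i * Q i0 i)](sum_indicator i0 (fun j => c * (u i * Q j i))).
    rewrite -[c ^+ 2 * Q i0 i](sum_indicator i0 (fun j => c ^+ 2 * Q j i)).
    rewrite !mulr_sumr -!sumrB mulr_sumr -sumrB.
    by apply: eq_bigr => j _; rewrite (Qsym j i); ring.
  rewrite !sumrB sum_indicator -mulr_sumr; ring.
have Q00 : 0 <= Q i0 i0.
  have := Q0 (fun i => 0 - (-1) * (i == i0)%:R); rewrite quad.
  rewrite big1 => [|i _]; last by rewrite big1// => j _; rewrite !mul0r.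
  rewrite big1 => [|j _]; last by rewrite mul0r.
  by rewrite mulr0 subr0 add0r sqrrN expr1n mul1r.
(* With a zero pivot the form is affine in [t] along the direction [i0]; a nonzero slope would make
   it equal to -1 at the [t] chosen below. *)
have row0 j : Q i0 i0 = 0 -> Q i0 j = 0.
  move=> q0; have [->//|jneq] := eqVneq j i0.
  have h t : 0 <= Q j j - 2 * t * Q i0 j.
    have := Q0 (fun i => (i == j)%:R - t * (i == i0)%:R); rewrite quad q0 mulr0 addr0.
    rewrite sum_indicator.
    rewrite (eq_bigr (fun i => (i == j)%:R * \sum_k (k == j)%:R * Q i k)).
      by rewrite !sum_indicator.
    by move=> i _; rewrite mulr_sumr; apply: eq_bigr => k _; rewrite mulrA.
  apply/eqP/negPn/negP => qn0.
  have := h ((Q j j + 1) / (2 * Q i0 j)).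
  rewrite (_ : 2 * _ * _ = Q j j + 1); last by field.
  by rewrite opprD addNKr oppr_ge0 ler10.
have Q'row j : Q' i0 j = 0.
  rewrite /Q' /r; have [q0|q0] := eqVneq (Q i0 i0) 0; last by field.
  by rewrite (row0 j q0) !mulr0 subr0.
(* Schur complement: the rank-one part pairs with [mu] to a value of the form [mu] at the row [i0]
   of [Q]. *)
have -> : \sum_i \sum_j Q i j * mu i j = \sum_i \sum_j Q' i j * mu i j +
    r * \sum_i \sum_j Q i0 i * Q i0 j * mu i j.
  rewrite mulr_sumr -big_split/=; apply: eq_bigr => i _.
  rewrite mulr_sumr -big_split/=; apply: eq_bigr => j _; rewrite /Q'; ring.
rewrite addr_ge0 ?mulr_ge0 ?invr_ge0//; apply: (IH Q').
- by move=> i j; rewrite /Q' Qsym; ring.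
- move=> u.
  (* The shift along [i0] that minimizes the form [Q]; the minimum is the form [Q'] at [u]. *)
  have := Q0 (fun i => u i - r * (\sum_j u j * Q i0 j) * (i == i0)%:R).
  rewrite quad; set S := \sum_j u j * Q i0 j.
  have -> : \sum_i \sum_j u i * u j * Q' i j =
      \sum_i \sum_j u i * u j * Q i j - r * S ^+ 2.
    rewrite expr2 {1}/S mulr_suml mulr_sumr -sumrB; apply: eq_bigr => i _.
    rewrite /S !mulr_sumr -sumrB; apply: eq_bigr => j _; rewrite /Q'; ring.
  have -> // : \sum_i \sum_j u i * u j * Q i j - 2 * (r * S) * S + (r * S) ^+ 2 * Q i0 i0 =
    \sum_i \sum_j u i * u j * Q i j - r * S ^+ 2.
  rewrite /r; have [q0|q0] := eqVneq (Q i0 i0) 0; last by field.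
  by rewrite q0 invr0; ring.
- move=> i j; have [->//|ii0] := eqVneq i i0.
  move=> si; have Qi k : Q i k = 0 by rewrite Qs// inE (negbTE ii0).
  by rewrite /Q' Qi Qsym Qi; ring.
Qed.

(** Symmetrizing [Q] keeps it positive semidefinite and doubles the pairing, as [mu] is
    symmetric. *)
Lemma psd_inner (mu Q : I -> I -> R) : (forall i j, mu i j = mu j i) ->
  (forall u : I -> R, 0 <= \sum_i \sum_j u i * u j * mu i j) ->
  (forall u : I -> R, 0 <= \sum_i \sum_j u i * u j * Q i j) ->
  0 <= \sum_i \sum_j Q i j * mu i j.
Proof.
move=> musym mu0 Q0.
have := @psd_inner_sym mu mu0 (enum I) (fun i j => Q i j + Q j i).
have -> : \sum_i \sum_j (Q i j + Q j i) * mu i j = 2 * \sum_i \sum_j Q i j * mu i j.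
  transitivity (\sum_i \sum_j Q i j * mu i j + \sum_i \sum_j Q j i * mu j i).
    rewrite -big_split/=; apply: eq_bigr => i _; rewrite -big_split/=.
    by apply: eq_bigr => j _; rewrite (musym j i) mulrDl.
  by rewrite [X in _ + X]exchange_big/= mulr2n mulrDl !mul1r.
rewrite pmulr_rge0//; apply.
- by move=> i j; rewrite addrC.
- move=> u; rewrite (_ : \sum_i _ =
    \sum_i \sum_j u i * u j * Q i j + \sum_i \sum_j u j * u i * Q j i).
    by rewrite [X in _ + X]exchange_big/= addr_ge0.
  rewrite -big_split/=; apply: eq_bigr => i _; rewrite -big_split/=.
  by apply: eq_bigr => j _; ring.
- by move=> i j; rewrite mem_enum.
Qed.

End psd.

(** * Pseudo-expectations *)

Section degree.
Context (R : realType) (n : nat).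
Implicit Types p q : {mpoly R[n]}.

Lemma deg_leS d d' p : (d <= d')%N -> deg_le d p -> deg_le d' p.
Proof. by move=> dd' pd; rewrite /deg_le (leq_trans pd). Qed.

Lemma deg_leD d p q : deg_le d p -> deg_le d q -> deg_le d (p + q).
Proof.
by move=> pd qd; rewrite /deg_le (leq_trans (msizeD_le _ _))// geq_max; apply/andP.
Qed.

Lemma deg_leZ d c p : deg_le d p -> deg_le d (c *: p).
Proof. by move=> pd; rewrite /deg_le (leq_trans (msizeZ_le _ _)). Qed.

Lemma deg_leM d e p q : deg_le d p -> deg_le e q -> deg_le (d + e) (p * q).
Proof.
rewrite /deg_le => pd qe.
have [->|p0] := eqVneq p 0; first by rewrite mul0r msize0.
have [->|q0] := eqVneq q 0; first by rewrite mulr0 msize0.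
by rewrite msizeM// -subn1 leq_subLR (leq_trans (leq_add pd qe))// addSn addnS.
Qed.

Lemma deg_le0 d : deg_le d (0 : {mpoly R[n]}).
Proof. by rewrite /deg_le msize0. Qed.

Lemma deg_leX i : deg_le 1 (Xv i : {mpoly R[n]}).
Proof. by rewrite /deg_le /Xv msizeX mdeg1. Qed.

Lemma deg_le_sum (I : finType) d (F : I -> {mpoly R[n]}) :
  (forall i, deg_le d (F i)) -> deg_le d (\sum_i F i).
Proof.
move=> Fd; elim/big_ind: _ => //; [exact: deg_le0|by move=> *; exact: deg_leD].
Qed.

End degree.

Section pseudo_expectation.
Context (R : realType) (n : nat) (Et : {mpoly R[n]} -> R).
Hypothesis HE : pseudo_expectation 4 Et.

Let E0 : Et 0 = 0.
Proof.
case: HE => lin _ _; have := lin 1 0 0 (deg_le0 _ _ _) (deg_le0 _ _ _).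
by rewrite scaler0 addr0; lra.
Qed.

Lemma pseudo_expectationD p q : deg_le 4 p -> deg_le 4 q -> Et (p + q) = Et p + Et q.
Proof. by case: HE => lin _ _ pd qd; rewrite -[p in LHS]scale1r lin// mul1r. Qed.

Lemma pseudo_expectationZ c p : deg_le 4 p -> Et (c *: p) = c * Et p.
Proof.
by case: HE => lin _ _ pd; rewrite -[_ *: _]addr0 lin ?deg_le0// E0 addr0.
Qed.

Lemma pseudo_expectation_sum (I : finType) (F : I -> {mpoly R[n]}) :
  (forall i, deg_le 4 (F i)) -> Et (\sum_i F i) = \sum_i Et (F i).
Proof.
move=> Fd.
have [//] : deg_le 4 (\sum_i F i) /\ Et (\sum_i F i) = \sum_i Et (F i).
apply: (big_ind2 (fun p e => deg_le 4 p /\ Et p = e)).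
- by rewrite deg_le0 E0.
- move=> p e q e' [pd <-] [qd <-]; rewrite deg_leD//; split=> //.
  exact: pseudo_expectationD.
- by move=> i _; rewrite Fd.
Qed.

Lemma pseudo_expectation_mul (I J : finType) (u : I -> R) (v : J -> R)
    (p : I -> {mpoly R[n]}) (q : J -> {mpoly R[n]}) :
  (forall i, deg_le 2 (p i)) -> (forall j, deg_le 2 (q j)) ->
  Et ((\sum_i u i *: p i) * (\sum_j v j *: q j)) =
  \sum_i \sum_j u i * v j * Et (p i * q j).
Proof.
move=> pd qd.
have pqd i j : deg_le 4 (p i * q j) by exact: (deg_leM (pd i) (qd j)).
rewrite mulr_suml pseudo_expectation_sum; last first.
  move=> i; rewrite mulr_sumr; apply: deg_le_sum => j.
  by rewrite -scalerAl -scalerAr; do 2 apply: deg_leZ.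
apply: eq_bigr => i _; rewrite mulr_sumr pseudo_expectation_sum => [|j]; last first.
  by rewrite -scalerAl -scalerAr; do 2 apply: deg_leZ.
apply: eq_bigr => j _.
by rewrite -scalerAl -scalerAr scalerA pseudo_expectationZ.
Qed.

Lemma pseudo_expectation_sqr_ge0 p : deg_le 2 p -> 0 <= Et (p * p).
Proof. by case: HE => _ _; apply. Qed.

Lemma pseudo_expectation_sqrB t p q : deg_le 2 p -> deg_le 2 q ->
  Et ((t *: p - q) * (t *: p - q)) =
  t ^+ 2 * Et (p * p) - 2 * t * Et (p * q) + Et (q * q).
Proof.
move=> pd qd.
have ppd : deg_le 4 (p * p) by exact: (deg_leM pd pd).
have pqd : deg_le 4 (p * q) by exact: (deg_leM pd qd).
have qqd : deg_le 4 (q * q) by exact: (deg_leM qd qd).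
have -> : (t *: p - q) * (t *: p - q) =
    t ^+ 2 *: (p * p) + ((- (2 * t)) *: (p * q) + q * q).
  by rewrite -!mul_mpolyC mpolyCN !mpolyCM; ring.
rewrite pseudo_expectationD ?deg_leD ?deg_leZ// pseudo_expectationD ?deg_leZ//.
by rewrite !pseudo_expectationZ//; ring.
Qed.

End pseudo_expectation.

(** Two Cauchy-Schwarz inequalities in quadratic form. With [r] the fourth root of [N4], the choice
    [s = r^2] gives [N2 <= r^2], and then [t = lam r] gives [e <= lam r^3]. *)
Lemma three_quarter_power_bound (R : realType) (e N2 N4 lam : R) : 0 < lam ->
  0 <= N4 -> (forall s, 2 * s * N2 <= s ^+ 2 + N4) ->
  (forall t, 2 * t * e <= t ^+ 2 * N2 + lam ^+ 2 * N4) ->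
  e <= lam * N4 `^ (3 / 4).
Proof.
move=> lam0 N40 hs ht.
(* Here [r] vanishes and cannot be divided by; [s = N2] and [t = 1] serve instead. *)
have [N40'|N4n0] := eqVneq N4 0.
  rewrite N40' powR0 ?mulr0; last by rewrite gt_eqF// divr_gt0.
  have N2le : N2 <= 0.
    rewrite leNgt; apply/negP => N2gt; have := hs N2; rewrite N40'; nra.
  by have := ht 1; rewrite N40'; lra.
have N4gt : 0 < N4 by rewrite lt_neqAle eq_sym N4n0.
set r := N4 `^ (1 / 4).
have rgt : 0 < r by rewrite powR_gt0.
have r4 : r ^+ 4 = N4.
  by rewrite /r -powR_mulrn ?powR_ge0// -powRrM (_ : 1 / 4 * 4 = 1) ?powRr1//; field.
have r3 : N4 `^ (3 / 4) = r ^+ 3.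
  by rewrite /r -powR_mulrn ?powR_ge0// -powRrM; congr (_ `^ _); field.
rewrite r3.
have N2r : N2 <= r ^+ 2.
  rewrite -(@ler_pM2l _ (2 * r ^+ 2)) ?mulr_gt0 ?exprn_gt0//.
  by have := hs (r ^+ 2); rewrite -r4; nra.
rewrite -(@ler_pM2l _ (2 * (lam * r))) ?mulr_gt0//.
apply: le_trans (ht _) _; rewrite -r4.
have : (lam * r) ^+ 2 * N2 <= (lam * r) ^+ 2 * r ^+ 2 by rewrite ler_wpM2l// sqr_ge0.
have -> : 2 * (lam * r) * (lam * r ^+ 3) =
  (lam * r) ^+ 2 * r ^+ 2 + lam ^+ 2 * r ^+ 4 by ring.
lra.
Qed.

(** The cubic is the sum of [x_i g_i] with [g_i] the quadratic form of [A_i]. The sum of the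
    pseudo-expectations of [g_i^2] is the pairing of [sum_i A_i (x) A_i] with the moment matrix, at
    most [lam^2] times the fourth moment by [psd_inner]. *)
Lemma pseudo_expectation_cubic_le (R : realType) (n : nat)
    (a : 'I_n -> 'I_n -> 'I_n -> R) (lam : R) (Et : {mpoly R[n]} -> R) : 0 < lam ->
  (forall u : 'I_n * 'I_n -> R,
     0 <= \sum_p \sum_q u p * u q * certificate a lam p q) ->
  pseudo_expectation 4 Et ->
  Et (tensor_poly a) <= lam * Et (@norm4_poly R n) `^ (3 / 4).
Proof.
move=> lam0 cert_ge0 HE.
pose m2 (p : 'I_n * 'I_n) : {mpoly R[n]} := Xv p.1 * Xv p.2.
have m2d p : deg_le 2 (m2 p) by exact: (deg_leM (deg_leX _ p.1) (deg_leX _ p.2)).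
pose mu x y z t := Et (m2 (x, y) * m2 (z, t)).
have muC x y z t : mu x y z t = mu x z y t by congr (Et _); rewrite /m2 /=; ring.
pose g i : {mpoly R[n]} := \sum_p a i p.1 p.2 *: m2 p.
have gd i : deg_le 2 (g i) by apply: deg_le_sum => p; exact: deg_leZ.
pose s2 : {mpoly R[n]} := \sum_(x < n) 1 *: m2 (x, x).
have s2d : deg_le 2 s2 by apply: deg_le_sum => x; exact: deg_leZ.
have s2E : s2 = \sum_i Xv i ^+ 2.
  by apply: eq_bigr => i _; rewrite scale1r /m2 expr2.
have Xd i : deg_le 2 (Xv i : {mpoly R[n]}) by exact: deg_leS (deg_leX _ _).
have N4E : Et (@norm4_poly R n) = \sum_x \sum_y mu x x y y.
  rewrite /norm4_poly -s2E expr2 (pseudo_expectation_mul HE)//.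
  by apply: eq_bigr => x _; apply: eq_bigr => y _; rewrite !mul1r.
have fE : Et (tensor_poly a) = \sum_i Et (Xv i * g i).
  rewrite -(pseudo_expectation_sum HE); last first.
    by move=> i; apply: (@deg_leS _ _ 3) => //; exact: (deg_leM (deg_leX _ i) (gd i)).
  congr (Et _); apply: eq_bigr => i _; rewrite /g mulr_sumr sum_pair.
  apply: eq_bigr => j _; apply: eq_bigr => k _.
  by rewrite -scalerAr /m2 mulrA.
have N2E : Et s2 = \sum_i Et (Xv i * Xv i).
  rewrite (pseudo_expectation_sum HE).
    by apply: eq_bigr => i _; rewrite scale1r.
  by move=> i; apply: (@deg_leS _ _ 2) => //; exact: deg_leZ.
have GE : \sum_i Et (g i * g i) =
    \sum_p \sum_q mu p.1 p.2 q.1 q.2 * kron_sum a p q.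
  transitivity (\sum_i \sum_p \sum_q a i p.1 p.2 * a i q.1 q.2 * mu p.1 p.2 q.1 q.2).
    by apply: eq_bigr => i _; rewrite (pseudo_expectation_mul HE).
  rewrite exchange_big/= sum_pair sum_pair; apply: eq_bigr => x _.
  transitivity (\sum_y \sum_z \sum_t \sum_i a i x y * a i z t * mu x y z t).
    by apply: eq_bigr => y _; rewrite exchange_big/= sum_pair.
  rewrite exchange_big/=; apply: eq_bigr => z _.
  rewrite sum_pair; apply: eq_bigr => y _; apply: eq_bigr => t _ /=.
  rewrite /kron_sum mulr_sumr; apply: eq_bigr => i _ /=.
  by rewrite muC; ring.
have G_le : \sum_i Et (g i * g i) <= lam ^+ 2 * Et (@norm4_poly R n).
  rewrite GE N4E -(certificate_moment a lam muC) -subr_ge0 -sumrB.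
  under eq_bigr => p _ do rewrite -sumrB.
  have := @psd_inner R _ (fun p q => mu p.1 p.2 q.1 q.2) (certificate a lam) _ _ cert_ge0.
  have -> : \sum_p \sum_q certificate a lam p q * mu p.1 p.2 q.1 q.2 =
      \sum_p \sum_q (mu p.1 p.2 q.1 q.2 * (certificate a lam p q + kron_sum a p q) -
        mu p.1 p.2 q.1 q.2 * kron_sum a p q).
    by apply: eq_bigr => p _; apply: eq_bigr => q _; ring.
  apply; first by move=> p q; congr (Et _); rewrite mulrC.
  move=> u; have ud : deg_le 2 (\sum_p u p *: m2 p).
    by apply: deg_le_sum => p; exact: deg_leZ.
  by have := pseudo_expectation_sqr_ge0 HE ud; rewrite (pseudo_expectation_mul HE).
apply: (@three_quarter_power_bound _ _ (Et s2)) => //.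
- by rewrite /norm4_poly -s2E expr2; exact: pseudo_expectation_sqr_ge0.
(* Positivity at the square of [s - |x|^2]. *)
- move=> s; have d1 : deg_le 2 (1 : {mpoly R[n]}).
    by rewrite /deg_le -mpolyC1 msizeC oner_eq0.
  have := pseudo_expectation_sqr_ge0 HE
    (deg_leD (deg_leZ s d1) (deg_leZ (-1) s2d)).
  rewrite scaleN1r (pseudo_expectation_sqrB HE)// !mul1r.
  case: (HE) => _ -> _; rewrite mulr1 -expr2 s2E -/(norm4_poly n) -s2E; lra.
(* Positivity at the squares of [t x_i - g_i], summed over [i]. *)
- move=> t; apply: le_trans (lerD (lexx _) G_le).
  rewrite fE N2E !mulr_sumr -big_split/=; apply: ler_sum => i _.
  have := pseudo_expectation_sqr_ge0 HE
    (deg_leD (deg_leZ t (Xd i)) (deg_leZ (-1) (gd i))).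
  rewrite scaleN1r (pseudo_expectation_sqrB HE)//; lra.
Qed.

(** * Numerical thresholds and assembly *)

Lemma expR1_le4 (R : realType) : expR 1 <= 4 :> R.
Proof.
have h : 2^-1 <= expR (- 2^-1) :> R by have := expR_ge1Dx (- 2^-1 : R); lra.
have e0 := expR_gt0 (2^-1 : R).
have e2 : expR 2^-1 <= 2 :> R.
  by rewrite -[leRHS]invrK -[leLHS]invrK -expRN lef_pV2 ?posrE ?expR_gt0// invr_gt0.
rewrite (_ : 1 = 2^-1 + 2^-1 :> R); last by field.
by rewrite expRD; nra.
Qed.

(** Since [n >= 4 >= e], the logarithmic factor is at least 1, and the level [n^(3/2)] lies below
    the square of the stated threshold. *)
Lemma threshold_sqr (R : realType) (n : nat) (C : R) : (4 <= n)%N -> 0 <= C ->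
  C ^+ 2 * (n%:R * Num.sqrt n%:R) <=
    (C * (n%:R `^ (3 / 4)) * (ln n%:R `^ (1 / 4))) ^+ 2 :> R.
Proof.
move=> n4 C0.
have n0 : 0 < n%:R :> R by rewrite ltr0n (leq_trans _ n4).
set x := n%:R `^ (3 / 4); set y := ln n%:R `^ (1 / 4).
have x0 : 0 <= x by exact: powR_ge0.
have x2 : x ^+ 2 = n%:R * Num.sqrt n%:R.
  apply/eqP; rewrite -(@eqrXn2 _ 2) ?mulr_ge0//; apply/eqP.
  rewrite -exprM exprMn sqr_sqrtr ?ltW// -exprSr.
  by rewrite /x -!powR_mulrn ?powR_ge0 ?ltW// -powRrM; congr (_ `^ _); field.
have ln1 : 1 <= ln n%:R :> R.
  rewrite -[leLHS]expRK ler_ln ?posrE ?expR_gt0//.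
  by rewrite (le_trans (expR1_le4 R))// ler_nat.
have y1 : 1 <= y.
  rewrite -[leLHS]/((fun=> 1) (1 / 4 : R)) -powR1 /y.
  by apply: ge0_ler_powR; rewrite ?nnegrE ?divr_ge0 ?(le_trans ler01 ln1).
rewrite !exprMn x2 ler_peMr ?exprn_ege1//.
by rewrite !mulr_ge0 ?exprn_ge0 ?sqrtr_ge0.
Qed.

Theorem mainTheorem2 (R : realType) :
  exists C K : R, 0 < C /\ 0 < K /\
  forall n : nat, (0 < n)%N ->
  forall (d : measure_display) (T : measurableType d) (P : probability T R)
         (A : 'I_n * 'I_n * 'I_n -> {RV P >-> R}),
    mutually_independent A ->
    (forall t, std_normal (A t)) ->
    let lam := C * (n%:R `^ (3 / 4)) * (ln n%:R `^ (1 / 4)) in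
    exists E : set T,
      [/\ measurable E,
          (P E >= (1 - K / n%:R ^+ 10)%:E)%E
        & forall w, E w ->
            lambda_bounded (tensor_poly (fun i j k => A (i, j, k) w)) lam /\
            (forall Et : {mpoly R[n]} -> R, pseudo_expectation 4 Et ->
               Et (tensor_poly (fun i j k => A (i, j, k) w))
                 <= lam * (Et (@norm4_poly R n) `^ (3 / 4)))].
Proof.
(* The certificate needs [400 n + 800 n^(3/2) <= C^2 n^(3/2)], and [C^2 = 1600]. The value of [K]
   makes the probability bound trivial for [n <= 3], which includes [n = 1], where [lam]
   vanishes. *)
exists 40, (3 ^+ 10); split; first by []; split; first by rewrite exprn_gt0.
move=> n n0 d T P A indepA normA lam.
have nR0 : 0 < n%:R :> R by rewrite ltr0n.
have [n4|n3] := leqP 4 n; last first.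
  exists set0; split=> //.
  rewrite measure0 lee_fin subr_le0 ler_pdivlMr ?exprn_gt0// mul1r.
  by apply: lerXn2r; rewrite ?nnegrE// ler_nat.
have [E1 [mE1 PE1 H1]] := injective_norm_event n0 indepA normA.
have [E2 [mE2 PE2 H2]] := lower_coupling_event n0 indepA normA.
exists (E1 `&` E2); split; first exact: measurableI.
  have mC : measurable (~` (E1 `&` E2)) by exact/measurableC/measurableI.
  rewrite -[E1 `&` E2]setCK probability_setC// EFinB leeB//.
  rewrite setCI; apply: (le_trans (measureU2 _ _ _)); try exact: measurableC.
  apply: (le_trans (leeD PE1 PE2)); rewrite -EFinD lee_fin.
  have : expR (- (10 * n%:R)) <= (n%:R ^+ 10)^-1 :> R.
    rewrite expRN lef_pV2 ?posrE ?expR_gt0 ?exprn_gt0//.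
    rewrite expRM_natl lerXn2r ?nnegrE ?expR_ge0//.
    by apply: le_trans (expR_ge1Dx _); rewrite lerDr.
  have z0 : 0 <= (n%:R ^+ 10)^-1 :> R by rewrite invr_ge0 exprn_ge0.
  have K2 : 2 <= 3 ^+ 10 :> R.
    by rewrite (@le_trans _ _ 3) ?ler_nat// ler_eXnr// ler1n.
  move: (ler_wpM2r z0 K2); move: (3 ^+ 10) (_ ^-1) => K z; lra.
move=> w [Ew1 Ew2].
set a := fun i j k => A (i, j, k) w.
have lam_gt0 : 0 < lam.
  rewrite /lam !mulr_gt0 ?powR_gt0// ln_gt0// ltr1n.
  by rewrite (leq_trans _ n4).
have aK := H1 w Ew1; have aB := H2 w Ew2 aK.
have cert : forall u : 'I_n * 'I_n -> R,
    0 <= \sum_p \sum_q u p * u q * certificate a lam p q.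
  apply: (@certificate_ge0 _ _ _ _ (20 * Num.sqrt n%:R) (400 * (n%:R * Num.sqrt n%:R))) => //.
  have := @threshold_sqr R n 40 n4 (ler0n R 40); apply: le_trans.
  have s1 : 1 <= Num.sqrt n%:R :> R by rewrite -[leLHS]sqrtr1 ler_wsqrtr// ler1n.
  have : n%:R <= n%:R * Num.sqrt n%:R :> R by rewrite ler_peMr.
  rewrite exprMn sqr_sqrtr ?ler0n//; lra.
split; first by apply: lambda_bounded_certificate => //; rewrite gt_eqF.
by move=> Et HEt; exact: pseudo_expectation_cubic_le.
Qed.
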